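(* There exist absolute constants $C_1,C_2>0$ such that the following holds. For every $\beta>0$ there exists $C>0$ such that for every integer $t=t(n)\ge 3$ with $\frac{C_1}{\log(1/\beta)}\log n\le t\le(1-C_2\beta)n$ and for any $p=p(n)\ge\frac Cn$, if $G$ is a graph on $n$ vertices satisfying $$e(G)\ge ex(n,C_t)+\beta\binom n2,$$ then with high probability $G(p)$ contains a copy of $C_t$.
   Context: Graphs are finite and simple; $e(G)$ is the number of edges of $G$; $\log$ is the natural logarithm; $C_t$ is the cycle of length $t$ (with $t$ edges). $ex(n,H)$ is the maximum number of edges in a graph on $n$ vertices containing no copy of $H$. For a graph $G$ and $p\in[0,1]$, $G(p)$ is the random subgraph of $G$ obtained by keeping each edge of $G$ independently with probability $p$. ''With high probability'' means with probability tending to $1$ as $n\to\infty$ (here $G=G_n$, $t=t(n)$, $p=p(n)$ are sequences satisfying the hypotheses for every $n$). For $\beta\ge1$ no graph satisfies the edge condition, and the statement is understood to be vacuous. *)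

(* Defs.v *)
From HB Require Import structures.
From mathcomp Require Import all_boot all_order all_algebra.
From mathcomp Require Import all_classical all_reals all_analysis.

Set Implicit Arguments.
Unset Strict Implicit.
Unset Printing Implicit Defensive.

Import Order.TTheory GRing.Theory Num.Theory.
Import numFieldNormedType.Exports.

Local Open Scope ring_scope.

(* A finite simple graph on the vertex type T, given by its edge set. *)
Definition sgraph (T : finType) : Type :=
  {E : {set {set T}} | [forall e in E, #|e| == 2%N]}.

Definition edges (T : finType) (G : sgraph T) : {set {set T}} := val G.

Definition num_edges (T : finType) (G : sgraph T) : nat := #|edges G|.

(* Copies are not required to be induced. *)
Definition contains_copy (T U : finType) (G : sgraph T) (H : sgraph U) : bool :=
  [exists f : {ffun U -> T},
    injectiveb f && [forall e in edges H, (f @: e) \in edges G]].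

(* [ordS i] is i + 1 modulo t. The filter on #|e| only discards the loop
   which would appear for t = 1; it removes nothing when 3 <= t. *)
Definition cycle_edges (t : nat) : {set {set 'I_t}} :=
  [set e in [set [set i; ordS i] | i : 'I_t] | #|e| == 2%N].

Lemma cycle_edgesP (t : nat) : [forall e in cycle_edges t, #|e| == 2%N].
Proof. by apply/forall_inP => e; rewrite inE => /andP[]. Qed.

Definition cycle_graph (t : nat) : sgraph 'I_t :=
  exist _ (cycle_edges t) (cycle_edgesP t).

(* The maximum over the empty family is 0; this does not occur for H = C_t
   with 3 <= t, since the edgeless graph contains no copy of C_t. *)
Definition extremal_number (n : nat) (U : finType) (H : sgraph U) : nat :=
  \max_(G : sgraph 'I_n | ~~ contains_copy G H) num_edges G.

(* The law of G(p): each spanning subgraph F of G has probability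
   p ^ e(F) * (1 - p) ^ (e(G) - e(F)). *)
Definition random_subgraph_prob (R : realType) (T : finType) (G : sgraph T)
    (p : R) (A : pred (sgraph T)) : R :=
  \sum_(F : sgraph T | (edges F \subset edges G) && A F)
    \prod_(e in edges G) (if e \in edges F then p else 1 - p).

(* Main.v *)
(** By definition of the extremal number, deleting fewer than [beta * 'C(n, 2)]
    edges of [G] never destroys all copies of [C_t].  Take a regular partition of
    [G] into clusters of equal size and delete the edges outside the dense regular
    pairs, together with the edges at a small reserved part of each cluster.  A
    surviving copy of [C_t] is a closed walk of length [t] in the reduced graph
    which does not exhaust any cluster.

    A union bound over pairs of vertex sets shows that with high probability
    [G(p)] has an edge between any two sets spanning a positive proportion of all
    pairs as edges of [G]; in particular any two large subsets of a dense regular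
    pair are joined by an edge of [G(p)].  This suffices to realise a cycle of
    length exactly [t] along the closed walk.  Long alternating paths inside
    single pairs, found by depth-first search, absorb most of the length; they are
    connected through walks of bounded length in the reduced graph whose parities
    add up to that of [t], and through trees of exactly prescribed logarithmic
    depth grown in expanders inside the reserved parts. *)

Require Import Defs.
From HB Require Import structures.
From mathcomp Require Import all_boot all_order all_algebra.
From mathcomp Require Import zify ring lra.

Set Implicit Arguments.
Unset Strict Implicit.
Unset Printing Implicit Defensive.

(** * Paths and fans in joined pairs *)

(** For [p] of order $1/n$ the random graph may have isolated vertices, so nothing is known about
    single vertices or small sets: its only property used below is that sets of linear size are
    joined. A path with a given endpoint is therefore continued through a tree of branching [k],
    whose [k ^ l = a] leaves are numerous enough to be joined to the next target. Each tree costs a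
    branch of length [l], about $\log n/\log k$. For a short cycle three branches suffice, and [k]
    exceeds $\beta^{-6}$, which turns the lower bound on [t] into [3 * l + B <= t]. For a long cycle
    [t] is linear in [n], and one tree for every edge of the reduced graph that the walk uses is
    affordable.

    The length spent inside a dense pair follows the number of times the closed walk uses that pair.
    Each cluster then receives about as many vertices as the copy of $C_t$ in the dense graph has
    there, so that nearly spanning cycles are treated like all other long ones. Long paths in a pair
    only change the length by even amounts; the parity is inherited from the walk, whose length is
    [t]. *)

Lemma cardsU_le (T : finType) (A B : {set T}) : #|A :|: B| <= #|A| + #|B|.
Proof. by rewrite cardsU leq_subr. Qed.

Definition fiber (T : finType) (K : eqType) (c : T -> K) i : {set T} := [set v | c v == i].

Section Joined.
Variables (T : finType) (adj : rel T).
Hypothesis adjC : symmetric adj.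

(** The pair has no bipartite hole with both sides of size at least [a]. *)
Definition joined (a : nat) (A B : {set T}) : Prop :=
  forall X Y : {set T}, X \subset A -> Y \subset B -> a <= #|X| -> a <= #|Y| ->
  exists x y, [/\ x \in X, y \in Y & adj x y].

Definition nbhd (X : {set T}) : {set T} := [set y | [exists x in X, adj x y]].

Lemma joinedS a (A B A' B' : {set T}) :
  A' \subset A -> B' \subset B -> joined a A B -> joined a A' B'.
Proof. by move=> sA sB jAB X Y sX sY; apply: jAB; [apply: subset_trans sA|apply: subset_trans sB]. Qed.

Lemma joinedC a (A B : {set T}) : joined a A B -> joined a B A.
Proof.
move=> jAB X Y sX sY aX aY; have [x [y [xY yX xy]]] := jAB Y X sY sX aY aX.
by exists y, x; rewrite adjC.
Qed.

Lemma joined_nbhd a (A B X : {set T}) :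
  joined a A B -> X \subset A -> a <= #|X| -> #|B :\: nbhd X| < a.
Proof.
move=> jAB sX aX; rewrite ltnNge; apply/negP => aB.
have [x [y [xX /setDP[_ yN] xy]]] := jAB X _ sX (subsetDl B (nbhd X)) aX aB.
by case/negP: yN; rewrite inE; apply/existsP; exists x; rewrite xX.
Qed.

Lemma nbhdU X Z : nbhd (X :|: Z) = nbhd X :|: nbhd Z.
Proof.
apply/setP => y; rewrite !inE; apply/existsP/orP => [[x]|[]/existsP[x /andP[xX xy]]].
- by rewrite inE => /andP[/orP[xX|xX] xy]; [left|right]; apply/existsP; exists x; rewrite xX.
- by exists x; rewrite inE xX.
- by exists x; rewrite inE xX orbT.
Qed.

(* Removing a maximal pair of non-expanding small sets leaves an expander. *)
Lemma expander_clean a K (A B : {set T}) :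
  joined a A B -> (2 * K + 2) * a <= #|A| -> (2 * K + 2) * a <= #|B| -> 0 < a ->
  exists A' B' : {set T}, [/\ A' \subset A /\ B' \subset B,
    #|A :\: A'| <= a, #|B :\: B'| <= a,
    forall X : {set T}, X \subset A' -> #|X| <= a -> K * #|X| <= #|nbhd X :&: B'| &
    forall Y : {set T}, Y \subset B' -> #|Y| <= a -> K * #|Y| <= #|nbhd Y :&: A'| ].
Proof.
move=> jAB lA lB a0.
pose bad (A B X Y : {set T}) := [&& X \subset A, #|X| <= a & #|nbhd X :&: (B :\: Y)| <= K * #|X|].
pose P (A B : {set T}) (q : {set T} * {set T}) := bad A B q.1 q.2 && bad B A q.2 q.1.
have P0 : P A B (set0, set0).
  have nb0 : nbhd set0 = set0.
    by apply/setP => y; rewrite !inE; apply/existsP => -[x]; rewrite inE.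
  by rewrite /P /bad /= !sub0set cards0 nb0 !set0I cards0.
have [X0 PX max] := @arg_maxnP _ (set0, set0) (P A B) (fun q => #|q.1| + #|q.2|) P0.
have expand (C D X Y : {set T}) : joined a C D -> (2 * K + 2) * a <= #|D| ->
    P C D (X, Y) -> (forall q, P C D q -> #|q.1| + #|q.2| <= #|X| + #|Y|) ->
    forall Z : {set T}, Z \subset C :\: X -> #|Z| <= a -> K * #|Z| <= #|nbhd Z :&: (D :\: Y)|.
  move=> jCD lD /andP[/and3P[/= sX aX bX] /and3P[/= sY aY bY]] maxXY Z sZ aZ.
  rewrite leqNgt; apply/negP => ltZ.
  have [sZC dZX] : Z \subset C /\ [disjoint Z & X] by apply/andP; rewrite -subsetD.
  have cXZ : #|X :|: Z| = #|X| + #|Z|.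
    by rewrite cardsU [X :&: Z]setIC disjoint_setI0 // cards0 subn0.
  have bXZ : #|nbhd (X :|: Z) :&: (D :\: Y)| <= K * #|X :|: Z|.
    rewrite nbhdU setIUl (leq_trans (cardsU_le _ _)) // cXZ mulnDr.
    by rewrite leq_add // ltnW.
  have sXZ : X :|: Z \subset C by rewrite subUset sX.
  have [leXZ|ltXZ] := leqP #|X :|: Z| a.
    (* Enlarging [X] shrinks the side in which [Y] would have to expand, so [Y] stays non-expanding
       and maximality is violated. *)
    have : P C D (X :|: Z, Y).
      apply/andP; split; apply/and3P; split => //=.
      by rewrite (leq_trans _ bY) // subset_leq_card // setIS // setDS // subsetUl.
    move=> /maxXY /=; rewrite cXZ; have : #|Z| != 0; last by lia.
    by apply: contraTneq ltZ => ->; rewrite muln0.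
  (* The union has between [a] and [2 * a] elements, so fewer than [a] vertices of [D] are not its
     neighbours. At most [2 * K * a] neighbours lie outside [Y], and [Y] has at most [a] elements:
     [D] would be too small. *)
  have := joined_nbhd jCD sXZ (ltnW ltXZ).
  move: (nbhd (X :|: Z)) bXZ => N bXZ.
  have : #|D| <= #|N :&: (D :\: Y)| + #|D :\: N| + #|Y|.
    have s : D \subset (N :&: (D :\: Y)) :|: (D :\: N) :|: Y.
      by apply/subsetP => v vD; rewrite !inE vD; case: (v \in Y); case: (v \in N).
    apply: leq_trans (subset_leq_card s) _.
    by apply: leq_trans (cardsU_le _ _) _; rewrite leq_add2r cardsU_le.
  have : K * #|X :|: Z| <= K * (2 * a) by rewrite leq_mul2l; apply/orP; right; lia.
  lia.
case: X0 PX max => X Y PX max; exists (A :\: X), (B :\: Y).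
have [/and3P[/= sX aX _] /and3P[/= sY aY _]] := andP PX.
have setDDl (C D : {set T}) : D \subset C -> C :\: (C :\: D) = D.
  by move=> sD; rewrite setDDr setDv set0U; apply/setIidPr.
split; rewrite ?setDDl // ?subsetDl //.
  by apply: expand jAB lB PX _ => q /max.
apply: expand (joinedC jAB) lA _ _; first by rewrite /P andbC.
by move=> [Y' X'] /= PYX; rewrite addnC [leqRHS]addnC; apply: (max (X', Y')); rewrite /P andbC.
Qed.

(** The leaves of a tree of depth [l] rooted at [u], without the tree: only one branch is ever used,
    so the paths to different leaves may overlap. The root need not lie in [Z]. *)
Definition fan (a l : nat) (u : T) (Z L : {set T}) : Prop :=
  a <= #|L| /\ forall x, x \in L -> exists s : seq T,
    [/\ size s = l, path adj u s, last u s = x, uniq (u :: s) & {subset s <= Z}].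

Lemma subset_of_card (A : {set T}) k : k <= #|A| -> exists2 X : {set T}, X \subset A & #|X| = k.
Proof.
elim: k A => [|k IH] A kA; first by exists set0; rewrite ?sub0set ?cards0.
have [X sX cX] := IH A (ltnW kA).
have /set0Pn[v /setDP[vA vX]] : A :\: X != set0.
  by rewrite -card_gt0 cardsD (setIidPr sX) cX subn_gt0.
by exists (v |: X); rewrite ?subUset ?sub1set ?vA // cardsU1 vX cX.
Qed.

(** Breadth-first layers, trimmed to exactly [k ^ r] vertices. The set [H] of all vertices used so
    far has at most [2 * k ^ r] elements, so expansion by [k + 2] leaves [k * k ^ r] fresh vertices
    for the next layer. *)
Lemma expander_fan a k l (A B : {set T}) u :
  1 < k -> (k ^ l <= a) ->
  (forall X : {set T}, X \subset A -> #|X| <= a -> (k + 2) * #|X| <= #|nbhd X :&: B|) ->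
  (forall Y : {set T}, Y \subset B -> #|Y| <= a -> (k + 2) * #|Y| <= #|nbhd Y :&: A|) ->
  u \in A ->
  exists2 L : {set T}, L \subset (if odd l then B else A) & fan (k ^ l) l u (A :|: B) L.
Proof.
move=> k1 kl eA eB uA.
suff [X [H [sX cX cH sH pX]]] : exists X H : {set T}, [/\ X \subset (if odd l then B else A),
   #|X| = k ^ l, #|H| <= 2 * k ^ l, X \subset H &
   u \in H /\ forall x, x \in X -> exists s : seq T,
    [/\ size s = l, path adj u s, last u s = x, uniq (u :: s) &
       {subset s <= (A :|: B) :&: H}] ].
  exists X => //; split; first by rewrite cX.
  by move=> x /(proj2 pX)[s [? ? ? ? ss]]; exists s; split => // v /ss /setIP[].
elim: l kl => [|r IH] kl.
  exists [set u], [set u]; rewrite /= sub1set uA cards1 expn0; split => //.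
  by rewrite inE; split => // x; rewrite inE => /eqP ->; exists [::].
have klr : k ^ r <= a by rewrite (leq_trans _ kl) // leq_pexp2l //; lia.
have [X [H [sX cX cH sH [uH pX]]]] := IH klr.
set S := if odd r.+1 then B else A.
have eX : (k + 2) * k ^ r <= #|nbhd X :&: S|.
  by rewrite -cX /S /=; move: sX; case: (odd r) => /= sX; [apply: eB|apply: eA]; rewrite ?cX.
have cN : k ^ r.+1 <= #|(nbhd X :&: S) :\: H|.
  rewrite cardsD; have := subset_leq_card (subsetIr (nbhd X :&: S) H).
  by move: eX; rewrite expnS mulnDl; lia.
have [Y sY cY] := subset_of_card cN.
have YS : Y \subset S by apply: subset_trans sY _; rewrite subDset subsetU // subsetIr orbT.
have sAB : S \subset A :|: B by rewrite /S; case: ifP; rewrite ?subsetUl ?subsetUr.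
exists Y, (H :|: Y); split=> //.
- have := cardsU_le H Y; rewrite cY expnS.
  have : 2 * k ^ r <= k * k ^ r by rewrite leq_mul2r k1 orbT.
  lia.
- exact: subsetUr.
split; first by rewrite inE uH.
move=> y yY; have /setDP[/setIP[] + yS yH] := subsetP sY y yY.
rewrite inE => /existsP[x /andP[xX xy]].
have [s [ss ps ls us sub]] := pX x xX.
exists (rcons s y); split.
- by rewrite size_rcons ss.
- by rewrite rcons_path ps ls.
- by rewrite last_rcons.
- rewrite -rcons_cons rcons_uniq us andbT inE negb_or.
  apply/andP; split; first by apply: contraNneq yH => ->.
  by apply: contra yH => /sub /setIP[].
move=> v; rewrite mem_rcons inE => /orP[/eqP->|/sub].
  by rewrite !inE yY orbT andbT -in_setU (subsetP sAB).
by rewrite !inE => /andP[-> ->].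
Qed.

(** The even depth brings the leaves back to the side of the root. The constant [2 * k + 6] is
    [2 * K + 2] for the expansion factor [K = k + 2]. *)
Lemma fan_expander a k l (A B : {set T}) :
  joined a A B -> a = k ^ l -> ~~ odd l -> 1 < k ->
  (2 * k + 6) * a <= #|A| -> (2 * k + 6) * a <= #|B| ->
  exists A' : {set T}, [/\ A' \subset A, #|A :\: A'| <= a &
    forall u, u \in A' -> exists2 L : {set T}, L \subset A & fan a l u (A :|: B) L].
Proof.
move=> jAB ea el k1 lA lB.
have a0 : 0 < a by rewrite ea expn_gt0; lia.
have [A' [B' [[sA sB] cA cB eA eB]]] : exists A' B' : {set T}, [/\ A' \subset A /\ B' \subset B,
    #|A :\: A'| <= a, #|B :\: B'| <= a,
    forall X : {set T}, X \subset A' -> #|X| <= a -> (k + 2) * #|X| <= #|nbhd X :&: B'| &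
    forall Y : {set T}, Y \subset B' -> #|Y| <= a -> (k + 2) * #|Y| <= #|nbhd Y :&: A'| ].
  by apply: expander_clean => //; nia.
exists A'; split=> // u uA.
have [|L sL] := expander_fan (l := l) k1 _ eA eB uA; first by rewrite ea.
rewrite (negPf el) -ea in sL * => -[aL fL].
exists L; first exact: subset_trans sA.
split=> // x /fL[s [? ? ? ? ss]]; exists s; split=> // v /ss.
by apply/subsetP: v; apply: setUSS.
Qed.

(** All of [X] is propagated at once: in each level, fewer than [a] of at least [2 * a] vertices
    have no neighbour among the survivors, so at least [a] survive. The price is that the ends in
    [X] and [B] cannot be prescribed. *)
Lemma connector a (W : eqType) (r : rel W) (C L : W -> {set T}) s p s' (X B : {set T}) :
  (forall s s', r s s' -> joined a (C s) (C s')) ->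
  (forall s, s \in p -> L s \subset C s /\ 2 * a <= #|L s|) ->
  X \subset C s -> a <= #|X| -> B \subset C s' -> a <= #|B| ->
  path r s (rcons p s') ->
  exists x xs b, [/\ x \in X, b \in B, path adj x (rcons xs b) &
                  all2 (fun x s => x \in L s) xs p].
Proof.
move=> jC; elim: p s X => [|s1 p IH] s X hL sX aX sB aB /=.
  rewrite andbT => /jC j; have [x [b [xX bB xb]]] := j X B sX sB aX aB.
  by exists x, [::], b; rewrite /= xb.
case/andP => /jC j p1.
have [sL aL] := hL s1 (mem_head _ _).
have aN : a <= #|L s1 :&: nbhd X|.
  have := joined_nbhd j sX aX; have : #|L s1 :\: nbhd X| <= #|C s1 :\: nbhd X|.
    by rewrite subset_leq_card // setSD.
  by rewrite cardsD; have := subset_leq_card (subsetIl (L s1) (nbhd X)); lia.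
have hL' z : z \in p -> L z \subset C z /\ 2 * a <= #|L z| by move=> zp; apply: hL; rewrite inE zp orbT.
have [x [xs [b [xX bB px hx]]]] := IH s1 _ hL'
   (subset_trans (subsetIl _ _) sL) aN sB aB p1.
move: xX; rewrite !inE => /andP[xL /existsP[x0 /andP[x0X x0x]]].
by exists x0, (x :: xs), b; split=> //=; rewrite ?x0x ?xL.
Qed.

(** Sides are counted from the end of the list, because the depth-first search pushes and pops at
    its head. *)
Fixpoint alternating (S : bool -> {set T}) (p : seq T) : bool :=
  if p is x :: q then (x \in S (odd (size q))) && alternating S q else true.

Lemma alternating_count (S : bool -> {set T}) p b :
  [disjoint S true & S false] -> alternating S p ->
  count (mem (S b)) p <= (size p + ~~ b)./2.
Proof.
move=> dS; elim: p => //= x q IH /andP[xS /IH{}IH].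
have eqb b' : (x \in S b') = (odd (size q) == b').
  apply/idP/eqP => [xb'|<-//]; apply: contraTeq isT => ne.
  have : x \in S true :&: S false.
    by rewrite inE; move: xS xb' ne; case: (odd _); case: b' => // -> ->.
  by rewrite disjoint_setI0 // inE.
by rewrite eqb; move: IH; case: b; case: eqP => /=; lia.
Qed.

Lemma alternating_cut S p q : alternating S (p ++ q) -> alternating S q.
Proof. by elim: p => //= x p IH /andP[_ /IH]. Qed.

(* Depth-first search: [D b] collects the dead ends of side [b], which have no
   unexplored neighbours; if one of them reached size [a], joinedness would fail. *)
Lemma dfs_path a y (S : bool -> {set T}) :
  joined a (S false) (S true) -> [disjoint S true & S false] -> 0 < a ->
  (forall b, y + 2 * a <= #|S b|) ->
  exists p, [/\ size p = 2 * y, sorted adj p, uniq p & alternating S p].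
Proof.
move=> jS dS a0 lS.
have jS' b : joined a (S b) (S (~~ b)) by case: b => //; apply: joinedC.
pose U (D : bool -> {set T}) (p : seq T) b := [set v in S b | (v \notin D b) && (v \notin p)].
(* The measure drops by one in every move: a push lengthens the path by one, while a pop shortens it
   by one and adds a dead end, which weighs two. *)
suff go n (D : bool -> {set T}) p : 2 * (2 * a - #|D true| - #|D false|) + (2 * y - size p) <= n ->
    (forall b, D b \subset S b /\ #|D b| < a) ->
    (forall b, {in D b & U D p (~~ b), forall v w, ~~ adj v w}) ->
    (forall b, {in D b, forall v, v \notin p}) ->
    size p <= 2 * y -> sorted adj p -> uniq p -> alternating S p ->
    exists p, [/\ size p = 2 * y, sorted adj p, uniq p & alternating S p].
  apply: (go _ (fun=> set0) [::]) => //.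
  - by move=> b; rewrite sub0set cards0.
  - by move=> b v w; rewrite inE.
elim: n D p => [|n IH] D p hn hD hDU hDp sp adp up altp.
  have := hD true; have := hD false; move=> [_ D1] [_ D2]; exists p; split=> //; lia.
have [ey|ny] := eqVneq (size p) (2 * y); first by exists p.
(* An alternating path shorter than [2 * y] uses at most [y] vertices of each side, and there are
   fewer than [a] dead ends there. *)
have cU b : a <= #|U D p b|.
  have -> : U D p b = S b :\: (D b :|: [set v in p | v \in S b]).
    by apply/setP => v; rewrite /U !inE; case: (v \in S b); case: (v \in D b); case: (v \in p).
  rewrite cardsD; set I := S b :&: _.
  have : #|I| <= #|D b| + #|[set v in p | v \in S b]|.
    by apply: leq_trans (subset_leq_card (subsetIr _ _)) (cardsU_le _ _).
  have : #|[set v in p | v \in S b]| <= y.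
    have -> : #|[set v in p | v \in S b]| = count (mem (S b)) p.
      rewrite -size_filter -(card_uniqP (filter_uniq _ up)); apply: eq_card => v.
      by rewrite !inE mem_filter andbC.
    by apply: leq_trans (alternating_count b dS altp) _; lia.
  have := (hD b).2; have := lS b; lia.
have hDp' b v w : w \in U D p b -> v \in D (~~ b) -> v != w.
  rewrite inE => /andP[wS _] vD; apply: contraTneq isT => evw.
  have : w \in S true :&: S false.
    rewrite inE; have := subsetP (hD (~~ b)).1 _ vD; rewrite evw.
    by move: wS; case: (b) => /= -> ->.
  by rewrite disjoint_setI0 // inE.
have push w : w \in U D p (odd (size p)) -> sorted adj (w :: p) ->
    exists p, [/\ size p = 2 * y, sorted adj p, uniq p & alternating S p].
  move=> wU adw; have := wU; rewrite inE => /and3P[wS wD wp].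
  apply: (IH D (w :: p)) => //=; rewrite ?wp ?wS //; try lia.
  - move=> b v x vD; rewrite inE => /and3P[xS xD]; rewrite inE negb_or => /andP[_ xp].
    by apply: (hDU b) => //; rewrite inE xS xD.
  - move=> b v vD; rewrite inE negb_or (hDp b) // andbT.
    have [eb|nb] := eqVneq b (odd (size p)); first by apply: contraNneq wD => <-; rewrite -eb.
    by apply: hDp' wU _; case: (odd _) b vD nb => -[].
case ep: p => [|x q].
  have /card_gt0P[w wU] : 0 < #|U D p (odd (size p))| by apply: leq_trans (cU _).
  by apply: (push w); rewrite // ep.
have [/existsP[w /andP[wU xw]]|nx] := boolP [exists w, (w \in U D p (odd (size p))) && adj x w].
  by apply: (push w) => //; rewrite ep /= adjC xw; move: adp; rewrite ep.
(* The head [x] has no unexplored neighbour: it is popped and becomes a dead end. *)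
set b0 := odd (size q).
have b0E : odd (size p) = ~~ b0 by rewrite ep.
have xS : x \in S b0 by move: altp; rewrite ep /= => /andP[].
have xp : x \in p by rewrite ep mem_head.
have xD : x \notin D b0 by apply: contraTN xp => /(hDp b0).
pose D' b := if b == b0 then x |: D b else D b.
have UE b : U D' q b \subset U D p b.
  apply/subsetP => v; rewrite !inE /D' ep inE => /and3P[vS + vq] /=.
  have vx : b != b0 -> v != x.
    move=> nb; apply: contraTneq isT => evx.
    have : x \in S true :&: S false.
      by rewrite inE; move: vS xS nb; rewrite evx; case: (b0); case: (b) => // -> ->.
    by rewrite disjoint_setI0 // inE.
  rewrite vS (negPf vq) orbF.
  case: eqP => [eb|/eqP nb vD]; first by rewrite in_setU1 negb_or eb => /andP[-> ->].
  by rewrite vD vx.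
have cD' : #|D' true| + #|D' false| = (#|D true| + #|D false|).+1.
  by rewrite /D'; move: xD; case: (b0) => /= xD; rewrite cardsU1 xD; lia.
have hD' b : D' b \subset S b.
  rewrite /D'; case: eqP => [->|_]; last by have [] := hD b.
  by rewrite subUset sub1set xS; have [] := hD b0.
have hDU' b : {in D' b & U D p (~~ b), forall v w, ~~ adj v w}.
  move=> v w + wU; rewrite /D'; case: eqP => [eb|_ vD]; last exact: hDU wU.
  rewrite in_setU1 => /orP[/eqP->|vD]; last exact: hDU wU.
  apply: contraNN nx => xw; apply/existsP; exists w; rewrite b0E -eb wU.
  exact: xw.
have aD b : #|D' b| < a.
  rewrite ltnNge; apply/negP => leD.
  have [|v [w [vD wU]]] := jS' b _ (U D p (~~ b)) (hD' b) _ leD (cU _); last first.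
    by move=> vw; case/negP: (hDU' b v w vD wU).
  by apply/subsetP => v; rewrite inE => /andP[].
apply: (IH D' q) => //.
- have := hD true; have := hD false; have := aD true; have := aD false.
  move: sp hn cD' => /=; rewrite ep /=. lia.
- by move=> b v w vD /(subsetP (UE _)); apply: hDU'.
- move=> b v; rewrite /D'; case: eqP => [_|_ /hDp]; last by rewrite ep inE negb_or => /andP[].
  rewrite in_setU1 => /orP[/eqP->|/hDp]; last by rewrite ep inE negb_or => /andP[].
  by move: up; rewrite ep => /andP[].
- by move: sp; rewrite ep => /ltnW.
- by move: adp; rewrite ep /=; apply: path_sorted.
- by move: up; rewrite ep => /andP[].
- by move: altp; rewrite ep => /andP[].
Qed.
End Joined.

(** * Cycles along a closed walk of clusters *)

Lemma alternating_take (T : finType) (S : bool -> {set T}) p q :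
  ~~ odd (size q) -> alternating S (p ++ q) -> alternating S p.
Proof.
move=> eq; elim: p => //= x p IH; rewrite size_cat oddD (negPf eq) addbF.
by move=> /andP[-> /IH].
Qed.

Lemma alternating_nth (T : finType) (S : bool -> {set T}) p x0 k :
  alternating S p -> k < size p -> nth x0 p k \in S (odd (size p - k.+1)).
Proof.
elim: p k => //= x p IH [|k]; first by rewrite subSS subn0 => /andP[].
by rewrite subSS ltnS => /andP[_ /IH]; apply.
Qed.

Section Link.
Variables (T : finType) (adj : rel T) (K : finType) (c : T -> K) (R : rel K) (g : T -> nat).
Variables (a k l : nat).
Hypotheses (adjC : symmetric adj) (RC : symmetric R).
Hypotheses (aE : a = k ^ l) (l_even : ~~ odd l) (k1 : 1 < k).

(* The map [g] splits each cluster: values 0 and 1 are the two levels crossed by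
   connecting walks, 2 to 4 host trees (2 and 3 in alternation, 4 for the tree
   that closes the cycle), 5 is slack for the depth-first search and 6 the rest. *)
Definition area i z : {set T} := [set v | (c v == i) && (g v == z)].
Definition bulk i : {set T} := [set v | (c v == i) && (5 <= g v)].
Definition zone z : {set T} := [set v | g v == 2 + z].
(** Only clusters incident to a pair of [R] have a controlled size, so the hypotheses on areas are
    restricted to them. *)
Definition full i := [exists j, R i j].
(* The boolean records the parity of the position, so that shortening a walk in
   [K * bool] changes its length by an even amount. *)
Definition walk_rel (s s' : K * bool) := R s.1 s'.1 && (s'.2 == ~~ s.2).

Hypothesis R_joined : forall i j, R i j -> joined adj a (fiber c i) (fiber c j).

Let a_gt0 : 0 < a. Proof. by rewrite aE expn_gt0; lia. Qed.

Lemma area_sub h x : area h x \subset fiber c h.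
Proof. by apply/subsetP => v; rewrite !inE => /andP[]. Qed.

Lemma walk_full s0 pw s1 s : path walk_rel s0 (rcons pw s1) -> s \in pw -> full s.1.
Proof.
elim: pw s0 => //= s2 pw IH s0 /andP[/andP[r _] p].
rewrite inE => /orP[/eqP->|]; last exact: IH p.
by apply/existsP; exists s0.1; rewrite RC.
Qed.

(** A vertex of a level determines its state, namely its cluster and its level. A repetition-free
    walk in [K * bool] thus passes through pairwise disjoint levels. *)
Lemma levels_uniq (P : {set T}) xs (pw : seq (K * bool)) :
  all2 (fun x (s : K * bool) => x \in area s.1 s.2 :\: P) xs pw -> uniq pw ->
  [/\ size xs = size pw, uniq xs & {in xs, forall v, v \notin P /\ g v < 2}].
Proof.
move=> hxs upw; split.
- by move: hxs; rewrite all2E => /andP[/eqP].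
- apply: (@map_uniq _ _ (fun v => (c v, g v == 1))); rewrite (_ : map _ _ = pw) //.
  elim: xs pw hxs {upw} => [[]//|x1 r IH [//|s1 pw1] /= /andP[x1s hr]].
  rewrite (IH _ hr); congr (_ :: _); move: x1s; rewrite !inE => /and3P[_ /eqP-> /eqP->].
  by case: s1 => h [].
elim: xs pw hxs {upw} => //= x1 r IH [//|s1 pw1] /andP[x1s hr] v.
rewrite inE => /orP[/eqP->|vr]; last exact: IH hr v vr.
by move: x1s; rewrite !inE => /andP[-> /andP[_ /eqP->]]; case: (s1.2).
Qed.

(* The search produces [2 * a] more pairs than needed.  Among the windows of
   [y.+1] pairs inside this path, fewer than [a] end at a vertex without neighbour
   in the expander of the next tree, and fewer than [a] start at a vertex that
   the fan does not reach. *)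
Lemma link (P L : {set T}) u i b pw i' b' j' y z :
  z < 2 -> fan adj a l u (zone z :\: P) L -> L \subset fiber c i ->
  path walk_rel (i, b) (rcons pw (i', b')) -> uniq pw -> R i' j' ->
  (forall i z, full i -> z < 5 -> (2 * k + 6) * a <= #|area i z :\: P|) ->
  (forall h, full h -> (y + 1 + 4 * a) * ((i' == h) + (j' == h)) <= #|bulk h :\: P|) ->
  exists Q L',
   [/\ [/\ path adj u Q, uniq Q, {in Q, forall v, v \notin P} & {in Q, forall v, v \notin zone 2}],
       [/\ size Q = l + size pw + 2 * y.+1 + 1,
           forall i z, z < 5 -> #|[set v in Q] :&: area i z| <= l + size pw + 1 &
           forall h, #|[set v in Q] :&: bulk h| <= y.+1 * ((i' == h) + (j' == h))],
       fan adj a l (last u Q) (zone (1 - z) :\: (P :|: [set v in Q])) L' &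
       L' \subset fiber c i'].
Proof.
move=> z2 fanL sL pwP upw Rij hA hB.
have fi : full i' by apply/existsP; exists j'.
have fj : full j' by apply/existsP; exists i'; rewrite RC.
set z' := 1 - z.
have jVij := R_joined Rij.
pose TA := area i' (2 + z') :\: P; pose TB := area j' (2 + z') :\: P.
have bulkV h : bulk h \subset fiber c h by apply/subsetP => v; rewrite !inE => /andP[].
have sTA : TA \subset fiber c i' by apply: subset_trans (subsetDl _ _) (area_sub _ _).
have sTB : TB \subset fiber c j' by apply: subset_trans (subsetDl _ _) (area_sub _ _).
(* Every vertex of [E] is a possible root of the next tree. That tree is fixed before a branch of
   the present one is chosen, and avoids it by living in the other zone. *)
have [||E [sE cE fanE]] := fan_expander adjC (joinedS sTA sTB jVij) aE l_even k1.
- by apply: hA => //; rewrite /z'; clear -z2; lia.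
- by apply: hA => //; rewrite /z'; clear -z2; lia.
have aE' : a <= #|E|.
  have : (2 * k + 6) * a <= #|TA| by apply: hA => //; rewrite /z'; clear -z2; lia.
  move: cE; rewrite cardsD (setIidPr sE); clear -a_gt0; nia.
have [A sA cA] : exists2 A : {set T}, A \subset bulk i' :\: P & #|A| = y + 1 + 4 * a.
  by apply: subset_of_card; have := hB _ fi; rewrite eqxx; clear; case: eqP; lia.
(* The reduced graph may have loops: if [i' = j'], both sides are cut from the same cluster, whose
   demand then counts twice. *)
have [B sB cB] : exists2 B : {set T}, B \subset (bulk j' :\: P) :\: A & #|B| = y + 1 + 4 * a.
  apply: subset_of_card; have := hB _ fj; rewrite eqxx; case: eqP => [eij|nij] /= hBj.
    by rewrite cardsD; have := subset_leq_card (subsetIr (bulk j' :\: P) A); move: hBj cA; clear; lia.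
  suff -> : (bulk j' :\: P) :\: A = bulk j' :\: P by move: hBj; clear; lia.
  apply/setDidPl; rewrite -setI_eq0; apply/eqP/setP => v; rewrite !inE.
  apply/negP => /andP[/and3P[_ /eqP ej _] /(subsetP sA)].
  by rewrite !inE => /and3P[_ /eqP ei _]; apply: nij; rewrite -ei -ej.
have sAV : A \subset fiber c i' by apply: subset_trans sA (subset_trans (subsetDl _ _) (bulkV _)).
have sBV : B \subset fiber c j'.
  by apply: subset_trans sB (subset_trans (subsetDl _ _) (subset_trans (subsetDl _ _) (bulkV _))).
pose S (b : bool) := if b then A else B.
have [||//|[]|p [sp adp up altp]] := @dfs_path _ _ adjC a (y + 1 + 2 * a) S.
- exact: joinedC (joinedS sAV sBV jVij).
- by rewrite disjoint_sym; have := sB; rewrite subsetD => /andP[].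
- by rewrite cA; clear; lia.
- by rewrite cB; clear; lia.
have pS v : v \in p -> v \in A :|: B.
  move=> vp; rewrite -(nth_index v vp).
  have := alternating_nth v altp; move=> /(_ (index v p)); rewrite index_mem vp => /(_ isT).
  by rewrite /S; case: ifP => _; rewrite inE => ->; rewrite ?orbT.
have pP v : v \in p -> v \notin P.
  by move=> /pS /setUP[/(subsetP sA)|/(subsetP sB)]; rewrite !inE => /andP[] // _ /andP[].
have pg v : v \in p -> 5 <= g v.
  move=> /pS /setUP[/(subsetP sA)|/(subsetP sB)]; first by rewrite !inE => /and3P[].
  by rewrite !inE => /and4P[].
have x0 := u.
have pA q : 2 * q < size p -> nth x0 p (2 * q) \in A.
  move=> hq; have := alternating_nth x0 altp hq.
  by have -> : odd (size p - (2 * q).+1) by rewrite sp; move: hq; rewrite sp; clear; lia.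
have pB q : (2 * q).+1 < size p -> nth x0 p (2 * q).+1 \in B.
  move=> hq; have := alternating_nth x0 altp hq.
  by have -> : odd (size p - (2 * q).+2) = false by rewrite sp; move: hq; rewrite sp; clear; lia.
pose I := [set q : 'I_(2 * a) | [exists w in E, adj (nth x0 p (2 * (q + y)).+1) w]].
have cI : a <= #|I|.
  rewrite leqNgt; apply/negP => ltI.
  have cIC : a <= #|~: I| by have := cardsC I; rewrite card_ord; move: ltI; clear; lia.
  pose X := [set nth x0 p (2 * (q + y)).+1 | q : 'I_(2 * a) in ~: I].
  have cX : #|X| = #|~: I|.
    apply: card_imset => q1 q2 /eqP; rewrite nth_uniq //; first by move/eqP => h;
        apply: val_inj => /=; move: h; clear; lia.
      by rewrite ?sp; have := ltn_ord q1; clear; lia.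
    by rewrite ?sp; have := ltn_ord q2; clear; lia.
  have [||||v [w [/imsetP[q qI ->] wE vw]]] := joinedC adjC jVij (X := X) (Y := E).
  - apply: subset_trans sBV; apply/subsetP => v /imsetP[q _ ->]; apply: pB.
    by rewrite ?sp; have := ltn_ord q; clear; lia.
  - exact: subset_trans sTA.
  - by rewrite cX.
  - exact: aE'.
  by move: qI; rewrite !inE => /existsP[]; exists w; rewrite wE.
(* The starts of the windows whose ends see [E]. The connector is free to choose among them, and the
   exit towards [E] is then guaranteed. *)
pose BS := [set nth x0 p (2 * q) | q : 'I_(2 * a) in I].
have cBS : a <= #|BS|.
  rewrite card_imset // => q1 q2 /eqP; rewrite nth_uniq //; first by move/eqP => h;
      apply: val_inj => /=; move: h; clear; lia.
    by rewrite ?sp; have := ltn_ord q1; clear; lia.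
  by rewrite ?sp; have := ltn_ord q2; clear; lia.
have sBS : BS \subset fiber c (i', b').1.
  apply: subset_trans sAV; apply/subsetP => v /imsetP[q _ ->]; apply: pA.
  by rewrite ?sp; have := ltn_ord q; clear; lia.
pose Lev (s : K * bool) := area s.1 s.2 :\: P.
have jW s s' : walk_rel s s' -> joined adj a (fiber c s.1) (fiber c s'.1) by move=> /andP[/R_joined].
have hLev s : s \in pw -> Lev s \subset fiber c s.1 /\ 2 * a <= #|Lev s|.
  move=> spw; split; first by apply: subset_trans (subsetDl _ _) (area_sub _ _).
  by apply: leq_trans (hA s.1 s.2 (walk_full pwP spw) _); [clear; nia|case: (s.2)].
have [x [xs [bb [xL bB pxs hxs]]]] :=
  connector (s := (i, b)) (C := fun s => fiber c s.1) jW hLev sL fanL.1 sBS cBS pwP.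
have /imsetP[q qI ebb] := bB.
have [s [ss ps ls us sub]] := fanL.2 x xL.
move: (qI); rewrite inE => /existsP[w /andP[wE adjw]].
have [L' sL' fanL'] := fanE w wE.
pose seg := take (2 * y.+1) (drop (2 * q) p).
have ltq := ltn_ord q.
have sseg : size seg = 2 * y.+1 by rewrite size_takel // size_drop sp; move: ltq; clear; lia.
have ssub : {subset seg <= p} by move=> v /mem_take /mem_drop.
have segh v : nth v seg 0 = bb.
  by rewrite ebb /seg nth_take // nth_drop addn0; apply: set_nth_default; rewrite sp; move: ltq;
      clear; lia.
have segl v : last v seg = nth x0 p (2 * (q + y)).+1.
  rewrite -nth_last (set_nth_default x0); last by rewrite sseg.
  by rewrite sseg nth_take // nth_drop; congr nth; clear; lia.
have segadj : sorted adj seg by apply/take_sorted/drop_sorted.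
have segu : uniq seg by apply/take_uniq/drop_uniq.
have altseg : alternating S seg.
  apply: (@alternating_take _ _ _ (drop (2 * y.+1) (drop (2 * q) p))).
    by rewrite !size_drop sp; move: ltq; clear; lia.
  rewrite cat_take_drop; apply: (@alternating_cut _ _ (take (2 * q) p)).
  by rewrite cat_take_drop.
have [sxs uxs xsP] := levels_uniq hxs upw.
have sP v : v \in s -> v \notin P /\ g v = 2 + z.
  by move=> /sub; rewrite !inE => /andP[-> /eqP].
have [wP gw cw] : [/\ w \notin P, g w = 2 + z' & c w = i'].
  by have := subsetP sE w wE; rewrite !inE => /and3P[-> /eqP-> /eqP->].
have segP v : v \in seg -> v \notin P /\ 5 <= g v by move=> /ssub vp; split; [apply: pP|apply: pg].
have z'2 : z' < 2 by rewrite /z'; clear -z2; lia.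
have zz' : z != z' by rewrite /z'; clear -z2; lia.
clearbody z'.
(* A branch of the current tree, the connecting walk, the window and the next root. The values of
   [g] on these four pieces are disjoint. *)
exists (s ++ xs ++ seg ++ [:: w]), L'; split.
- split.
  + rewrite cat_path ps ls /=.
    have -> : xs ++ seg ++ [:: w] = rcons xs bb ++ behead seg ++ [:: w].
      rewrite cat_rcons; move: (segh u) sseg; case: (seg) => [|y1 r] /=; first by [].
      by move=> -> _.
    rewrite cat_path pxs last_rcons /= cat_path /= andbT.
    move: (segh u) (segl bb) sseg segadj; case: (seg) => [|y1 r] //= -> -> _ ->.
    by rewrite adjw.
  + rewrite !cat_uniq /= uxs segu andbT; move: us => /= /andP[_ ->] /=.
    apply/and3P; split.
    * apply/hasPn => v; rewrite !mem_cat mem_seq1 => h; apply/negP => /sP [_ gv].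
      case/or3P: h => [/xsP[_]|/segP[_]|/eqP ev]; rewrite ?gv; [clear; lia|clear -z2; lia|].
      by move: gv; rewrite ev gw => /addnI /esym/eqP; apply/negP.
    * apply/hasPn => v; rewrite !mem_cat mem_seq1 => h; apply/negP => /xsP [_ gv].
      by case/orP: h => [/segP[_]|/eqP ev]; move: gv; rewrite ?ev ?gw; clear; lia.
    * rewrite orbF; apply/negP => /segP[_]; rewrite gw; clear -z'2; lia.
  + by move=> v; rewrite !mem_cat mem_seq1 => /or4P[/sP[]|/xsP[]|/segP[]|/eqP->].
  + move=> v; rewrite !mem_cat mem_seq1 inE => /or4P[/sP[_ ->]|/xsP[_]|/segP[_]|/eqP->].
    * by clear -z2; lia.
    * by clear; lia.
    * by clear; lia.
    * by rewrite gw; clear -z'2; lia.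
- split.
  + by rewrite !size_cat /= ss sxs sseg; clear; lia.
  + move=> h x1 hx1; have -> : [set v in s ++ xs ++ seg ++ [:: w]] :&: area h x1 =
       [set v in s ++ xs ++ [:: w]] :&: area h x1.
      apply/setP => v; rewrite !inE !mem_cat mem_seq1; case: (boolP (v \in seg)) => [/segP[_ gv]|_] //.
      have -> : (g v == x1) = false by apply/eqP => gx; move: gv; rewrite gx leqNgt hx1.
      by rewrite !andbF.
    apply: leq_trans (subset_leq_card (subsetIl _ _)) _.
    rewrite cardsE; apply: leq_trans (card_size _) _.
    by rewrite !size_cat /= ss sxs; clear; lia.
  + move=> h; apply: leq_trans (_ : #|[set v in seg] :&: fiber c h| <= _).
      apply/subset_leq_card/subsetP => v; rewrite !inE !mem_cat mem_seq1 => /and3P[+ -> gv].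
      rewrite andbT => /or4P[/sP[_ gv']|/xsP[_ gv']|//|/eqP ev].
      * by move: gv; rewrite gv'; clear -z2; lia.
      * by move: gv gv'; clear; lia.
      * by move: gv; rewrite ev gw; clear -z'2; lia.
    have cS b0 : #|[set v in seg] :&: S b0| <= y.+1.
      have -> : #|[set v in seg] :&: S b0| = count (mem (S b0)) seg.
        rewrite -size_filter -(card_uniqP (filter_uniq _ segu)); apply: eq_card => v.
        by rewrite !inE mem_filter andbC.
      have dS : [disjoint S true & S false].
        by rewrite disjoint_sym; have := sB; rewrite subsetD => /andP[].
      by apply: leq_trans (alternating_count b0 dS altseg) _; rewrite sseg; clear; lia.
    have cl (X : {set T}) h' : X \subset fiber c h' -> #|X :&: fiber c h| <= (h' == h) * #|X|.
      move=> sX; case: eqP => [_|nh]; first by rewrite mul1n subset_leq_card // subsetIl.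
      rewrite leqn0 cards_eq0; apply/eqP/setP => v; rewrite !inE.
      apply/negP => /andP[/(subsetP sX)]; rewrite inE => /eqP e1 /eqP e2.
      by apply: nh; rewrite -e1 -e2.
    have -> : [set v in seg] :&: fiber c h = (([set v in seg] :&: S true) :&: fiber c h) :|:
        (([set v in seg] :&: S false) :&: fiber c h).
      rewrite -setIUl -setIUr; congr (_ :&: _); apply/esym/setIidPl.
      by apply/subsetP => v; rewrite inE => /ssub /pS.
    apply: leq_trans (cardsU_le _ _) _; rewrite mulnDr; apply: leq_add.
      apply: leq_trans (cl _ i' _) _; first by apply: subset_trans (subsetIr _ _) sAV.
      by rewrite mulnC leq_mul2r cS orbT.
    apply: leq_trans (cl _ j' _) _; first by apply: subset_trans (subsetIr _ _) sBV.
    by rewrite mulnC leq_mul2r cS orbT.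
- rewrite !last_cat /=; split; first exact: fanL'.1.
  move=> v /fanL'.2 [s' [? ? ? us' subs']]; exists s'; split=> // v' vs'.
  have /setUP : v' \in TA :|: TB := subs' _ vs'.
  have gv' : v' \in TA :|: TB -> g v' = 2 + z' /\ v' \notin P.
    by rewrite !inE => /orP[] /and3P[-> _ /eqP].
  move=> _; have [gv nP] := gv' (subs' _ vs').
  rewrite !inE gv eqxx andbT negb_or nP /= !mem_cat mem_seq1 !negb_or.
  apply/and4P; split; apply/negP.
  + by move/sP => [_]; rewrite gv => /addnI /esym/eqP; apply/negP.
  + by move/xsP => [_]; rewrite gv; clear; lia.
  + by move/segP => [_]; rewrite gv; clear -z'2; lia.
  + by move/eqP => ev; move: us'; rewrite /= -ev vs'.
- exact: subset_trans sTA.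
Qed.

(** The data of one link: the connecting walk, the state it reaches, the other cluster of the pair
    carrying the long path, and the length parameter of that path. Window, next root and even tree
    form an even excursion that returns to the cluster of [seg_state], so the next segment departs
    from this same state, parity included. [seg_cost] bounds the vertices used outside the bulk,
    [seg_demand] those used in the bulk of a cluster. *)
Record segment := Segment
  { seg_walk : seq (K * bool); seg_state : K * bool; seg_next : K; seg_len : nat }.

Definition seg_cost s := l + size (seg_walk s) + 1.
Definition seg_size s := l + size (seg_walk s) + 2 * (seg_len s).+1 + 1.
Definition seg_demand s h := (seg_len s).+1 * (((seg_state s).1 == h) + (seg_next s == h)).

Fixpoint chained (s0 : K * bool) (ss : seq segment) pw s1 : bool :=
  if ss is s :: ss' then
    [&& path walk_rel s0 (rcons (seg_walk s) (seg_state s)), uniq (seg_walk s),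
        R (seg_state s).1 (seg_next s) & chained (seg_state s) ss' pw s1]
  else path walk_rel s0 (rcons pw s1) && uniq pw.

(** Induction over the segments, collecting the used vertices in [P] and exchanging the zones [z]
    and [1 - z] at each link. Zone 2 stays untouched for the closing tree. *)
Lemma chain_link ss (P L B : {set T}) u s0 z pw s1 :
  z < 2 -> fan adj a l u (zone z :\: P) L -> L \subset fiber c s0.1 ->
  chained s0 ss pw s1 -> B \subset fiber c s1.1 -> a <= #|B| ->
  (forall i x, full i -> x < 5 ->
     (2 * k + 6) * a + \sum_(s <- ss) seg_cost s <= #|area i x :\: P|) ->
  (forall h, full h -> 8 * a + \sum_(s <- ss) seg_demand s h <= #|bulk h :\: P|) ->
  exists Q x, [/\ x \in B, path adj u (rcons Q x), uniq Q,
    {in Q, forall v, v \notin P /\ v \notin zone 2} &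
    size Q = \sum_(s <- ss) seg_size s + l + size pw].
Proof.
move=> + + + + sB aB.
elim: ss P L u s0 z => [|sg ss IH] P L u s0 z z2 fanL sL.
  move=> /= /andP[pwP upw] hA _.
  have jW s s' : walk_rel s s' -> joined adj a (fiber c s.1) (fiber c s'.1).
    by move=> /andP[/R_joined].
  have hLev s : s \in pw -> area s.1 s.2 :\: P \subset fiber c s.1 /\
      2 * a <= #|area s.1 s.2 :\: P|.
    move=> /(walk_full pwP) fs; split; first by apply: subset_trans (subsetDl _ _) (area_sub _ _).
    by apply: leq_trans (hA s.1 s.2 fs _); [rewrite big_nil; clear; nia|case: (s.2)].
  have [x [xs [b [xL bB pxs hxs]]]] :=
    connector (C := fun s => fiber c s.1) jW hLev sL fanL.1 sB aB pwP.
  have [sxs uxs xsP] := levels_uniq hxs upw.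
  have [s [ss ps ls us sub]] := fanL.2 x xL.
  have sP v : v \in s -> v \notin P /\ g v = 2 + z.
    by move=> /sub; rewrite !inE => /andP[-> /eqP].
  exists (s ++ xs), b; split=> //.
  - by rewrite rcons_cat cat_path ps ls.
  - rewrite cat_uniq uxs andbT; move: us => /= /andP[_ ->] /=.
    by apply/hasPn => v /xsP[_ gv]; apply/negP => /sP[_]; move: gv; clear; lia.
  - move=> v; rewrite mem_cat inE => /orP[/sP[-> ->]|/xsP[-> gv]]; split=> //.
      by clear -z2; lia.
    by move: gv; clear; lia.
  by rewrite big_nil size_cat ss sxs.
case: sg => pw1 [i' b'] j' y /= /and4P[pwP upw Rij ch] hA hB.
case: s0 sL pwP => i b sL pwP.
have [||Q [L' [[pQ uQ dQ zQ] [sQ aQ bQ] fanL' sL']]] := link (y := y) z2 fanL sL pwP upw Rij.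
- by move=> h x fh x5; apply: leq_trans (hA h x fh x5); rewrite leq_addr.
(* The surplus of [4 * a] vertices per side is needed at most twice in one cluster, whence
   [8 * a]. *)
- move=> h fh; apply: leq_trans (hB h fh); rewrite big_cons /seg_demand /=.
  by clear; case: eqP; case: eqP => _ _; lia.
have z'2 : 1 - z < 2 by clear -z2; lia.
have cD (X Y Z : {set T}) : #|X :\: (Y :|: Z)| + #|Z :&: X| >= #|X :\: Y|.
  rewrite -(cardsID Z (X :\: Y)) setDDl addnC leq_add2l subset_leq_card //.
  by rewrite setIC setIS // subsetDl.
have [||Q' [x [xB pQ' uQ' dQ' sQ']]] := IH _ _ _ (i', b') _ z'2 fanL' sL' ch.
- move=> h x fh x5; have := hA h x fh x5; have := aQ h x x5.
  have := cD (area h x) P [set v in Q]; rewrite big_cons /seg_cost /=.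
  by clear; lia.
- move=> h fh; have := hB h fh; have := bQ h.
  have := cD (bulk h) P [set v in Q]; rewrite big_cons {1}/seg_demand /=.
  by clear; lia.
exists (Q ++ Q'), x; split=> //.
- by rewrite rcons_cat cat_path pQ.
- rewrite cat_uniq uQ uQ' andbT /=; apply/hasPn => v /dQ'[].
  by rewrite !inE negb_or => /andP[].
- move=> v; rewrite mem_cat => /orP[vQ|/dQ'[]]; first by split; [apply: dQ|apply: zQ].
  by rewrite inE negb_or => /andP[].
by rewrite size_cat sQ sQ' big_cons /seg_size /=; clear; lia.
Qed.

(** The closing edge joins the roots [x0] and [y0] of two trees: the chain starts in the tree of
    [x0] and ends at a leaf of the tree of [y0], which lies in zone 2. The strict inequality on
    areas makes room for the roots, which lie in different areas. *)
Lemma chained_cycle ss i0 j0 b pw :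
  0 < l -> R i0 j0 -> chained (i0, false) ss pw (j0, b) ->
  (forall i x, full i -> x < 5 ->
     (2 * k + 6) * a + \sum_(s <- ss) seg_cost s < #|area i x|) ->
  (forall h, full h -> 8 * a + \sum_(s <- ss) seg_demand s h <= #|bulk h|) ->
  exists p, [/\ uniq p, cycle adj p & size p = \sum_(s <- ss) seg_size s + 2 * l + size pw + 2].
Proof.
move=> l0 Rij ch hA hB.
have fi : full i0 by apply/existsP; exists j0.
have fj : full j0 by apply/existsP; exists i0; rewrite RC.
have jR := R_joined Rij; have jR' := joinedC adjC jR.
have hA' i x : full i -> x < 5 -> (2 * k + 6) * a <= #|area i x|.
  by move=> fi' x5; apply: leq_trans (ltnW (hA i x fi' x5)); rewrite leq_addr.
have [||X [sX cX fX]] := fan_expander adjC (joinedS (area_sub i0 2) (area_sub j0 2) jR) aE l_even k1.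
- exact: hA'.
- exact: hA'.
have [||Y [sY cY fY]] := fan_expander adjC (joinedS (area_sub j0 4) (area_sub i0 4) jR') aE l_even k1.
- exact: hA'.
- exact: hA'.
have aX : a <= #|X|.
  by have := hA' i0 2 fi isT; move: cX; rewrite cardsD (setIidPr sX); clear -a_gt0; nia.
have aY : a <= #|Y|.
  by have := hA' j0 4 fj isT; move: cY; rewrite cardsD (setIidPr sY); clear -a_gt0; nia.
have [x0 [y0 [x0X y0Y xy]]] := jR X Y (subset_trans sX (area_sub _ _)) (subset_trans sY (area_sub _
    _)) aX aY.
have [L sL fanL] := fX x0 x0X; have [B sB fanB] := fY y0 y0Y.
have gx0 : g x0 = 2 by have := subsetP sX _ x0X; rewrite !inE => /andP[_ /eqP].
have gy0 : g y0 = 4 by have := subsetP sY _ y0Y; rewrite !inE => /andP[_ /eqP].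
have [|||||Q [x [xB pQ uQ dQ sQ]]] := chain_link (P := [set x0;
    y0]) (L := L) (B := B) (u := x0) (z := 0) isT _ _ ch _ fanB.1.
- split; first exact: fanL.1.
  move=> v /fanL.2[s [? ? ? us sub]]; exists s; split=> // w ws.
  have gw : g w = 2 by have := sub w ws; rewrite !inE => /orP[]/andP[_ /eqP].
  rewrite !inE gw eqxx andbT negb_or; apply/andP; split; last by apply: contra_eqN gy0 => /eqP<-;
      rewrite gw.
  by apply: contraTneq us => <-; rewrite /= ws.
- exact: subset_trans sL (area_sub _ _).
- exact: subset_trans sB (area_sub _ _).
- move=> h z fh z5; have := hA h z fh z5; rewrite cardsD.
  suff : #|area h z :&: [set x0; y0]| <= 1 by clear; lia.
  rewrite -(cards1 (if z == 2 then x0 else y0)) subset_leq_card //.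
  apply/subsetP => v; rewrite !inE => /andP[/andP[_ /eqP <-] /orP[]/eqP->].
    by rewrite gx0.
  by rewrite gy0.
- move=> h fh; apply: leq_trans (hB h fh) _; rewrite (_ : _ :\: _ = bulk h) //.
  apply/setDidPl; rewrite -setI_eq0; apply/eqP/setP => v; rewrite !inE.
  by apply/negP => /andP[/andP[_ gv] /orP[]/eqP ev]; move: gv; rewrite ev ?gx0 ?gy0.
have [s [ss' ps ls us sub]] := fanB.2 x xB.
have gs v : v \in s -> g v = 4 by move=> /sub; rewrite !inE => /orP[]/andP[_ /eqP].
exists (y0 :: x0 :: Q ++ rev s); split.
- rewrite /= inE !mem_cat !mem_rev !negb_or cat_uniq uQ rev_uniq.
  have -> : y0 != x0 by apply: contra_eqN gx0 => /eqP<-; rewrite gy0.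
  move: us => /= /andP[-> ->].
  have nQ v : v \in [set x0; y0] -> v \notin Q by move=> vP; apply: contraL vP => /dQ[].
  rewrite !nQ ?inE ?eqxx ?orbT //= andbT.
  have -> /= : x0 \notin s by apply/negP => /gs; rewrite gx0.
  by apply/hasPn => v; rewrite mem_rev => /gs gv; apply/negP => /dQ[_]; rewrite inE gv.
- rewrite /= adjC xy /= rcons_cat -rev_cons lastI rev_rcons -cat_rcons cat_path.
  rewrite ls pQ last_rcons -ls rev_path /=.
  by rewrite (@eq_path _ _ adj).
rewrite /= size_cat size_rev sQ ss'; clear; lia.
Qed.
End Link.

(** * Prescribing the length of the cycle *)

(** Used to select one position for each edge of the reduced graph that a walk passes; as a
    subsequence, the selection respects the order of the walk. *)
Lemma exists_uniq_edges (E : eqType) (e : nat -> E) (s : seq nat) :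
  exists qs, [/\ subseq qs s, uniq [seq e q | q <- qs] & {subset [seq e q | q <- s] <= [seq e q | q
      <- qs]}].
Proof.
elim: s => [|q s [qs [ss us sub]]]; first by exists [::].
have [eq|neq] := boolP (e q \in [seq e q | q <- qs]).
  exists qs; split=> //; first exact: subseq_trans ss (subseq_cons _ _).
  by move=> x; rewrite inE => /orP[/eqP->|/sub].
exists (q :: qs); split=> /=; first by rewrite eqxx.
  by rewrite neq.
by move=> x; rewrite !inE => /orP[->//|/sub ->]; rewrite orbT.
Qed.

Lemma sum_bounded_choice (qs : seq nat) (Y : nat -> nat) e :
  uniq qs -> e <= \sum_(q <- qs) Y q ->
  exists2 y : nat -> nat, forall q, y q <= Y q & \sum_(q <- qs) y q = e.
Proof.
elim: qs e => [|q qs IH] e /=.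
  by rewrite big_nil leqn0 => _ /eqP->; exists (fun=> 0); rewrite ?big_nil.
case/andP => qn uqs; rewrite big_cons => le.
have [|y yY sy] := IH (e - minn e (Y q)) uqs; first by lia.
exists (fun x => if x == q then minn e (Y q) else y x).
  by move=> x; case: eqP => [->|_]; rewrite ?yY ?geq_minr.
rewrite big_cons eqxx (eq_big_seq y) ?sy; first by lia.
by move=> x xqs; case: eqP => // ex; move: qn; rewrite -ex xqs.
Qed.

Lemma sum_count (E : finType) (e : nat -> E) (s qs : seq nat) (F : E -> nat) :
  uniq [seq e q | q <- qs] -> {subset [seq e q | q <- s] <= [seq e q | q <- qs]} ->
  \sum_(j <- s) F (e j) = \sum_(q <- qs) count (fun j => e j == e q) s * F (e q).
Proof.
move=> uqs sub.
have key j : j \in s -> F (e j) = \sum_(q <- qs) (e j == e q) * F (e q).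
  move=> js; have : e j \in [seq e q | q <- qs] by apply: sub; apply: map_f.
  move=> ein; rewrite -(big_map e xpredT (fun x => (e j == x) * F x)) (bigD1_seq (e j)) //= eqxx mul1n.
  by rewrite big1 ?addn0 // => x; rewrite eq_sym => /negPf ->.
rewrite big_seq (eq_bigr _ key) -big_seq exchange_big /=; apply: eq_bigr => q _.
by rewrite -big_distrl /= -sum1_count [in RHS]big_mkcond /=; congr (_ * _); apply: eq_bigr => j _;
    case: eqP.
Qed.

Section Walk.
Variables (T : finType) (adj : rel T) (K : finType) (c : T -> K) (R : rel K) (g : T -> nat).
Variables (a k l t : nat) (w : nat -> K).
Hypotheses (wR : forall j, R (w j) (w j.+1)).

Let st j : K * bool := (w j, odd j).

(** The stretch of the walk between the two positions is shortened to a repetition-free one. Since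
    states carry the parity of the position, the parity of its length is kept. *)
Lemma connector_walk q q' : q < q' ->
  exists pw, [/\ path (walk_rel R) (st q) (rcons pw (st q')), uniq pw & size pw <= 2 * #|K|].
Proof.
move=> lt.
have stp j : walk_rel R (st j) (st j.+1) by rewrite /walk_rel /= wR eqxx.
have iop n j : path (walk_rel R) (st j) [seq st i | i <- iota j.+1 n].
  by elim: n j => //= n IH j; rewrite stp IH.
have lasti n j : last (st j) [seq st i | i <- iota j.+1 n] = st (j + n).
  by elim: n j => [|n IH] j /=; rewrite ?addn0 // IH addSnnS.
have := iop (q' - q.+1) q.+1; have := lasti (q' - q.+1) q.+1.
rewrite subnKC // => elast pst; move: elast.
case: (shortenP pst) => p' pp' up' _ elast.
exists (belast (st q.+1) p'); rewrite -elast -lastI /= stp pp'; split=> //.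
  by move: up'; rewrite lastI rcons_uniq => /andP[].
rewrite size_belast mulnC -card_bool -card_prod ltnW //.
by have := max_card [in st q.+1 :: p']; rewrite (card_uniqP up').
Qed.

(** The connecting walks are fixed before the lengths [y], so [D], their total number of inner
    states, does not depend on [y]. They have [D + size qs + 1] edges in all, with the parity of the
    stretch from [q0] to [q1]. *)
Lemma segments_exist q0 qs q1 : path ltn q0 (rcons qs q1) ->
  exists pw D, [/\ D <= (size qs).+1 * (2 * #|K|), odd (D + size qs + 1) = odd q0 (+) odd q1 &
   forall y : nat -> nat, exists ss, [/\ chained R (st q0) ss pw (st q1),
     \sum_(s <- ss) seg_size l s + size pw = D + size qs * (l + 3) + 2 * \sum_(q <- qs) y q,
     \sum_(s <- ss) seg_cost l s + size pw = D + size qs * l.+1 &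
     forall h, \sum_(s <- ss) seg_demand s h =
       \sum_(q <- qs) (y q).+1 * ((w q == h) + (w q.+1 == h))]].
Proof.
have parity s p : path (walk_rel R) s p -> (last s p).2 = s.2 (+) odd (size p).
  elim: p s => [|s1 p IH] s /=; first by rewrite addbF.
  by case/andP => /andP[_ /eqP e1] /IH ->; rewrite e1 addNb addbN.
elim: qs q0 => [|q qs IH] q0 /=.
  rewrite andbT => /connector_walk[pw [pp up sp]].
  exists pw, (size pw); split; rewrite ?mul1n //.
    by have := parity _ _ pp; rewrite last_rcons size_rcons /= addn0 addn1 => ->; rewrite addbA addbb.
  move=> y; exists [::]; split; rewrite ?big_nil //=; first by rewrite pp.
  - by clear; lia.
  - by clear; lia.
  - by move=> h; rewrite !big_nil.
case/andP => /connector_walk[pw1 [pp up sp]] /IH[pw [D [leD oD hD]]].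
exists pw, (size pw1 + D); split.
- by rewrite mulSn leq_add.
- have := parity _ _ pp; rewrite last_rcons size_rcons /= => e1.
  rewrite (_ : _ + 1 = (size pw1).+1 + (D + size qs + 1)); last by clear; lia.
  by rewrite oddD oD e1 /=; case: (odd q0); case: (odd q1); case: (odd (size pw1)).
move=> y; have [ss [ch s1 s2 s3]] := hD y.
exists (Segment pw1 (st q) (w q.+1) (y q) :: ss); split=> /=.
- by rewrite pp up wR ch.
- by rewrite !big_cons {1}/seg_size /=; move: s1; clear; lia.
- by rewrite !big_cons {1}/seg_cost /=; move: s2; clear; lia.
by move=> h; rewrite !big_cons s3.
Qed.

Hypotheses (adjC : symmetric adj) (RC : symmetric R).
Hypotheses (aE : a = k ^ l) (l_even : ~~ odd l) (l_gt0 : 0 < l) (k1 : 1 < k).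
Hypothesis R_joined : forall i j, R i j -> joined adj a (fiber c i) (fiber c j).
Hypothesis w_periodic : forall j, w (j + t) = w j.

(** The part of the length that does not depend on [y] is congruent to [D + size qs], hence to [t],
    modulo 2. Half of the missing length is distributed over the [y q] within the capacities
    [Y q]. *)
Lemma walk_cycle qs Y : path ltn 0 qs -> {in qs, forall q, q <= t} ->
  size qs * (l + 3) + 2 * l + 2 + (size qs).+1 * (2 * #|K|) <= t ->
  t <= 2 * \sum_(q <- qs) Y q + size qs ->
  (forall h x, full R h -> x < 5 ->
     (2 * k + 6) * a + size qs * l.+1 + (size qs).+1 * (2 * #|K|) < #|area c g h x|) ->
  (forall h, full R h ->
     8 * a + \sum_(q <- qs) (Y q).+1 * ((w q == h) + (w q.+1 == h)) <= #|bulk c g h|) ->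
  exists p, [/\ uniq p, cycle adj p & size p = t].
Proof.
move=> pqs qst let_ leY hA hB.
(* The walk runs beyond a full period to position [t.+1], that is to [w 1]; the pair of [w 1] and
   [w 0] then carries the closing edge. *)
have p0 : path ltn 0 (rcons qs t.+1).
  rewrite rcons_path pqs /= ltnS; have := mem_last 0 qs.
  by rewrite inE => /orP[/eqP->|/qst].
have [pw [D [leD oD hD]]] := segments_exist p0.
have uqs : uniq qs by have /= /andP[] := @sorted_uniq _ _ ltn_trans ltnn (0 :: qs) pqs.
pose e := (t - (D + size qs * (l + 3) + 2 * l + 2))./2.
have le_e : e <= \sum_(q <- qs) Y q by rewrite /e; move: leY; clear; lia.
have [y yY sy] := sum_bounded_choice uqs le_e.
have [ss [ch s1 s2 s3]] := hD y.
have w1 : st t.+1 = (w 1, odd t.+1) by rewrite /st -(w_periodic 1) add1n.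
have [|||p [up cp sp]] := @chained_cycle T adj K c R g a k l adjC RC aE l_even k1 R_joined
    ss (w 0) (w 1) (odd t.+1) pw l_gt0 (wR 0) _ _ _.
- by move: ch; rewrite w1.
- move=> h x fh x5; apply: leq_ltn_trans (hA h x fh x5).
  by move: s2 leD; clear; lia.
- move=> h fh; apply: leq_trans (hB h fh); rewrite leq_add2l s3.
  by apply: leq_sum => q _; rewrite leq_mul2r ltnS yY orbT.
exists p; split=> //; rewrite sp.
have : \sum_(s <- ss) seg_size l s + size pw = D + size qs * (l + 3) + 2 * e by rewrite s1 sy.
have : 2 * e = t - (D + size qs * (l + 3) + 2 * l + 2).
  rewrite /e mul2n even_halfK //.
  by move: let_ leD oD l_even; clear; nia.
by move: let_ leD; clear; nia.
Qed.

(** If [4 * t <= m], one long path in a single pair suffices. Otherwise a pair passed [x] times by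
    the walk may receive about [x / 2] vertices on each side. A cluster visited [v] times is an end
    of [2 * v] steps, so it receives at most [v] vertices plus a rounding error of [2 * size qs]. As
    [v <= m - 6 * s] and the bulk has [m - 5 * s] vertices, [s] vertices remain for this error and
    the search surplus. *)
Lemma closed_walk_cycle m s :
  (#|K| ^ 2 + 3) * (l + 2 * #|K| + 3) <= a -> s = (2 * k + 9) * a -> 12 * s <= m ->
  3 * l + 4 * #|K| + 5 <= t ->
  (forall h x, full R h -> x < 5 -> #|area c g h x| = s) ->
  (forall h, full R h -> #|bulk c g h| = m - 5 * s) ->
  (forall h, #|[set j : 'I_t | w j == h]| <= m - 6 * s) ->
  exists p, [/\ uniq p, cycle adj p & size p = t].
Proof.
move=> big_a sE sm let_ hA hB hW.
have K0 : 0 < #|K| by apply/card_gt0P; exists (w 0).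
have a0 : 0 < a by rewrite aE expn_gt0; move: k1; clear; lia.
have big3 n : n <= #|K| ^ 2 -> (n + 3) * (l + 2 * #|K| + 3) <= a.
  by move=> le; apply: leq_trans big_a; rewrite leq_mul2r leq_add2r le orbT.
have s12 : (2 * k + 9) * a = (2 * k + 6) * a + 3 * a by rewrite -mulnDl -addnA.
have [t4|t4] := leqP (4 * t) m.
  (* Three branches of depth [l] and two connecting walks: this is the origin of
     [3 * l + 4 * #|K| + 5]. *)
  apply: (walk_cycle (qs := [:: 1]) (Y := fun=> t)) => //=.
  - by move=> q; rewrite inE => /eqP->; move: let_; clear; lia.
  - by move: let_ => /=; clear; lia.
  - by rewrite big_seq1; clear; lia.
  - move=> h x fh x5; rewrite hA // sE s12; move: (big3 0 isT) => /=; clear; lia.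
  - move=> h fh; rewrite hB // big_seq1.
    have : 8 * a + 2 <= s by rewrite sE; move: a0 k1; clear; nia.
    by move: t4 sm; clear; case: eqP; case: eqP => _ _ /=; lia.
pose e j := (w j, w j.+1).
have [qs [sub uq cov]] := exists_uniq_edges e (iota 1 t).
have Nle : size qs <= #|K| ^ 2.
  by rewrite -(size_map e) -mulnn -card_prod -(card_uniqP uq) max_card.
pose x q := count (fun j => e j == e q) (iota 1 t).
apply: (walk_cycle (qs := qs) (Y := fun q => (x q)./2)) => //.
- apply: (subseq_path ltn_trans sub).
  exact: iota_ltn_sorted 0 t.+1.
- by move=> q /(mem_subseq sub); rewrite mem_iota add1n ltnS => /andP[].
- apply: leq_trans (_ : a <= _); last first.
    have : a <= s by rewrite sE leq_pmull // addnS.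
    by move: t4 sm; clear; lia.
  by apply: leq_trans (big3 _ Nle); rewrite /=; clear; nia.
- have <- : \sum_(j <- iota 1 t) 1 = t by rewrite big_const_seq count_predT size_iota iter_addn_0 mul1n.
  rewrite (sum_count (fun=> 1) uq cov) -sum1_size big_distrr -big_split /=.
  by apply: leq_sum => q _; rewrite muln1 -/(x q); clear; lia.
- move=> h z fh z5; rewrite hA // sE; rewrite s12; move: (big3 _ Nle) => /=; clear; nia.
move=> h fh; rewrite hB //.
have cnt (F : K * K -> nat) : \sum_(j <- iota 1 t) F (e j) = \sum_(q <- qs) x q * F (e q).
  exact: sum_count.
(* By periodicity any [t] consecutive positions visit [h] equally often, so steps out of [h] and
   steps into [h] are both counted by the visits. *)
have shift n : \sum_(j <- iota n t) (w j == h) = #|[set j : 'I_t | w j == h]|.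
  elim: n => [|n <-].
    have -> : iota 0 t = index_iota 0 t by rewrite /index_iota subn0.
    rewrite big_mkord -sum1_card [in RHS]big_mkcond /=.
    by apply: eq_bigr => j _; rewrite inE; case: eqP.
  apply/eqP; rewrite -(eqn_add2l (w n == h)) -(big_cons _ _ n _ xpredT (fun j => nat_of_bool (w j
      == h))).
  by rewrite -[n :: _]/(iota n t.+1) -addn1 iotaD big_cat /= big_seq1 w_periodic addnC.
have c0 := shift 1.
have c1 : \sum_(j <- iota 1 t) (w j.+1 == h) = #|[set j : 'I_t | w j == h]|.
  by rewrite -(shift 2) -[iota 2 t](map_id) -[2]/(1 + 1) iotaDl -map_comp big_map.
have s0 := cnt (fun p => (p.1 == h)); have s1 := cnt (fun p => (p.2 == h)).
rewrite /= c0 in s0; rewrite /= c1 in s1.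
have : \sum_(q <- qs) (x q)./2.+1 * ((w q == h) + (w q.+1 == h)) <= #|[set j :
    'I_t | w j == h]| + 2 * size qs.
  rewrite -(leq_pmul2l (isT : 0 < 2)) mulnDr [X in _ <= X + _]mul2n -addnn {1}s0 s1.
  rewrite mulnA -sum1_size !big_distrr -!big_split /=; apply: leq_sum => q _.
  by clear; case: eqP; case: eqP => _ _; lia.
have : 8 * a + 2 * size qs <= s.
  by rewrite sE s12; move: (big3 _ Nle) => /=; clear -k1; nia.
by move: sm (hW h) => /=; clear; lia.
Qed.
End Walk.

(** * Regular partitions *)

Section Index.
Variables (T : finType) (K : eqType) (c : T -> K).

Definition class_index u := index u (enum [set v | c v == c u]).

(** The ranks inside a class of size [N] run once through [0, ..., N - 1]. Cutting by ranks gives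
    blocks of exact size, both for the clusters and for the areas inside them. *)
Lemma card_class_index i (P : pred nat) :
  #|[set v | (c v == i) && P (class_index v)]| = count P (iota 0 #|[set v | c v == i]|).
Proof.
set s := enum [set v | c v == i].
have us : uniq s by apply: enum_uniq.
have -> : iota 0 #|[set v | c v == i]| = [seq index v s | v <- s].
  rewrite cardE -/s; apply: (@eq_from_nth _ 0); rewrite ?size_map ?size_iota // => j js.
  have v0 : T by case: (s) js => [|v0 _] //.
  by rewrite nth_iota // (nth_map v0) // index_uniq.
rewrite count_map -size_filter -(card_uniqP (filter_uniq _ us)); apply: eq_card => v.
rewrite inE mem_filter /s mem_enum inE /= andbC /class_index.
by case: (c v =P i) => e; rewrite ?e inE ?e ?eqxx ?andbT // (introF eqP e) !andbF.
Qed.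

Lemma class_index_lt u : class_index u < #|[set v | c v == c u]|.
Proof. by rewrite cardE index_mem mem_enum inE. Qed.
End Index.

Lemma count_iota_interval b len N :
  b + len <= N -> count (fun x => b <= x < b + len) (iota 0 N) = len.
Proof.
move=> h; rewrite -(subnKC h) !iotaD !count_cat add0n.
have e1 : count (fun x => b <= x < b + len) (iota 0 b) = 0.
  by apply/eqP; rewrite -leqn0 leqNgt -has_count; apply/hasPn => x; rewrite mem_iota; lia.
have e2 n : count (fun x => b <= x < b + len) (iota (b + len) n) = 0.
  by apply/eqP; rewrite -leqn0 leqNgt -has_count; apply/hasPn => x; rewrite mem_iota; lia.
rewrite e1 e2 add0n addn0 -[RHS](size_iota b); apply/eqP; rewrite -all_count.
by apply/allP => x; rewrite mem_iota.
Qed.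

Lemma count_iota_ge b N : count (fun x => b <= x) (iota 0 N) = N - b.
Proof.
have [h|h] := leqP b N.
  rewrite -(@count_iota_interval b (N - b) N) ?subnKC //.
  by apply: eq_in_count => x; rewrite mem_iota /= add0n => ->; rewrite andbT.
rewrite (_ : N - b = 0); last by lia.
by apply/eqP; rewrite -leqn0 leqNgt -has_count; apply/hasPn => x; rewrite mem_iota; lia.
Qed.

(** Ordered pairs: an edge with both ends in [A :&: B] counts twice. *)
Definition edge_count (T : finType) (adj : rel T) (A B : {set T}) : nat :=
  #|[set p in setX A B | adj p.1 p.2]|.

(** One-sided irregularity: a large subpair of density below [1 / (4 * D)], half of the threshold
    [1 / (2 * D)] from which a pair counts as dense. *)
Definition irregular (T : finType) (adj : rel T) (K : eqType) (c : T -> K) D m i j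
    (q : {set T} * {set T}) : bool :=
  [&& q.1 \subset fiber c i, q.2 \subset fiber c j, m <= D * #|q.1|, m <= D * #|q.2| &
      edge_count adj q.1 q.2 * (4 * D) < #|q.1| * #|q.2|].

Lemma edge_countC (T : finType) (adj : rel T) (A B : {set T}) :
  symmetric adj -> edge_count adj A B = edge_count adj B A.
Proof.
move=> adjC; have swap_inj : injective (fun p : T * T => (p.2, p.1)) by move=> [? ?] [? ?] [-> ->].
rewrite /edge_count -(card_imset _ swap_inj).
apply: eq_card => -[x y]; apply/imsetP/idP => [[[x' y']]|].
  by rewrite !inE /= => h [-> ->]; rewrite adjC [X in X && _]andbC.
rewrite !inE /= => /andP[/andP[xB yA] a].
by exists (y, x); rewrite // !inE /= xB yA adjC.
Qed.

Lemma irregularC (T : finType) (adj : rel T) (K : eqType) (c : T -> K) D m i j q :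
  symmetric adj -> irregular adj c D m i j q = irregular adj c D m j i (q.2, q.1).
Proof.
move=> adjC; rewrite /irregular /= (edge_countC _ _ adjC) [X in _ < X]mulnC.
by apply/and5P/and5P => -[].
Qed.

(** Each class is cut into blocks of [m] consecutive ranks. Only the last block of a class can be
    incomplete, which spoils at most [m * #|K|] vertices. Since [#|T|] is below
    [2 * m * (8 * D * #|K|)], the number of blocks is bounded independently of [T]. *)
Lemma chunk (T K : finType) (c : T -> K) D : 0 < D -> 8 * D * #|K| <= #|T| -> 0 < #|T| ->
  exists c0 : T -> K * 'I_(16 * D * #|K|).+1, (forall u, c u = (c0 u).1) /\
    8 * D * #|[set u | #|fiber c0 (c0 u)| != #|T| %/ (8 * D * #|K|)]| <= #|T|.
Proof.
move=> D0 leT T0; set m := _ %/ _.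
have K0 : 0 < #|K| by have /card_gt0P[v _] := T0; apply/card_gt0P; exists (c v).
have q0 : 0 < 8 * D * #|K| by rewrite !muln_gt0 D0 K0.
have m0 : 0 < m by rewrite divn_gt0.
have ltT : #|T| < m.+1 * (8 * D * #|K|) by rewrite ltn_ceil.
have idx_lt u : class_index c u %/ m < (16 * D * #|K|).+1.
  rewrite ltnS; apply: leq_trans (_ : #|T| %/ m <= _).
    apply: leq_div2r; apply/ltnW/(leq_trans (class_index_lt c u)); exact: max_card.
  rewrite -ltnS ltn_divLR //; apply: leq_trans ltT _.
  move: m0; rewrite /=; clear; nia.
exists (fun u => (c u, inord (class_index c u %/ m))); split=> //.
have fibE i (z : 'I_(16 * D * #|K|).+1) : z.+1 * m <= #|fiber c i| ->
    #|fiber (fun u => (c u, inord (class_index c u %/ m)) : K * 'I_(16 * D * #|K|).+1) (i, z)| = m.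
  move=> hz; transitivity (count (fun x => z * m <= x < z * m + m) (iota 0 #|fiber c i|)).
    rewrite -card_class_index; apply: eq_card => v; rewrite !inE -pair_eqE /=; congr (_ && _).
    rewrite -val_eqE /= inordK // eqn_leq -ltnS ltn_divLR // leq_divRL // andbC; congr (_ && _).
    by rewrite mulSn addnC.
  by rewrite count_iota_interval // addnC -mulSn.
set bad := [set u | _].
have -> : #|bad| = \sum_i #|[set u in bad | c u == i]|.
  rewrite -sum1_card (partition_big c xpredT) //=; apply: eq_bigr => i _.
  by rewrite -sum1_card; apply: eq_bigl => u; rewrite !inE.
apply: leq_trans (_ : 8 * D * (\sum_(i : K) m) <= _); last first.
  by rewrite sum_nat_const mulnA mulnC leq_trunc_div.
rewrite leq_mul2l; apply/orP; right; apply: leq_sum => i _.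
apply: leq_trans (_ : #|fiber c i| %% m <= _); last by rewrite ltnW // ltn_mod.
have -> : #|fiber c i| %% m = #|fiber c i| - #|fiber c i| %/ m * m.
  by rewrite {2}(divn_eq #|fiber c i| m) addKn.
rewrite -count_iota_ge -card_class_index; apply: subset_leq_card; apply/subsetP => u.
rewrite !inE => /andP[+ /eqP cu]; rewrite cu eqxx /=; apply: contraR; rewrite -ltnNge => lt.
rewrite -cu; apply/eqP/fibE; rewrite inordK // cu.
have : class_index c u %/ m < #|fiber c i| %/ m by rewrite ltn_divLR.
by rewrite -leq_divRL.
Qed.

(** Only the pairs in [R] are controlled, from below, and [R] may contain loops. Classes outside [R]
    may have any size, their edges being counted as lost in the last clause. *)
Definition regular_partition (T : finType) (adj : rel T) D Q : Prop :=
  exists (K : finType) (c : T -> K) (m : nat) (R : rel K),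
  [/\ [/\ #|K| <= Q, 0 < m & #|T| <= Q * m], symmetric R,
      forall i j, R i j -> #|fiber c i| = m,
      forall i j (A B : {set T}), R i j -> A \subset fiber c i -> B \subset fiber c j ->
        m <= D * #|A| -> m <= D * #|B| -> #|A| * #|B| <= edge_count adj A B * (4 * D) &
      D * #|[set p : T * T | adj p.1 p.2 && ~~ R (c p.1) (c p.2)]| <= #|T| ^ 2].

Lemma card_fiber_pair (T : finType) (K L : eqType) (c : T -> K) (d : T -> L) i j :
  #|fiber (fun p : T * T => (c p.1, d p.2)) (i, j)| = #|fiber c i| * #|fiber d j|.
Proof.
rewrite -cardsX; apply: eq_card => -[x y].
by rewrite !inE -pair_eqE.
Qed.

Import Order.TTheory GRing.Theory Num.Theory.
Local Open Scope ring_scope.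

(** * Energy increments and the regularity lemma *)

Section Energy.
Variables (F : realFieldType) (X : finType) (f : X -> F).
Hypothesis f01 : forall x, 0 <= f x <= 1.

(** The conditional mean of [f], which is 0 on an empty class because division by 0 gives 0.
    [energy] is the squared norm of the conditional expectation, not normalised. *)
Definition avg (L : finType) (C : X -> L) (l : L) : F :=
  (\sum_(y | C y == l) f y) / #|[set y | C y == l]|%:R.

Definition energy (L : finType) (C : X -> L) : F := \sum_x avg C (C x) ^+ 2.

Lemma sum_avg_class (L : finType) (C : X -> L) l :
  \sum_(x | C x == l) avg C (C x) = \sum_(x | C x == l) f x.
Proof.
rewrite (eq_bigr (fun=> avg C l)); last by move=> x /eqP->.
have sumc (a : F) : \sum_(x | C x == l) a = a * #|[set y | C y == l]|%:R.
  by rewrite mulr_natr -sumr_const; apply: eq_bigl => x; rewrite inE.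
rewrite sumc; have [e0|n0] := eqVneq #|[set y | C y == l]| 0%N.
  rewrite e0 mulr0 big_pred0 // => x; apply/negP => xl.
  by move/eqP: e0; rewrite cards_eq0 => /eqP/setP/(_ x); rewrite !inE xl.
by rewrite /avg mulfVK // pnatr_eq0.
Qed.

(** Conditional expectation is an orthogonal projection: [f] and its averages have the same inner
    product with every function of the classes. *)
Lemma sum_avg (L : finType) (C : X -> L) (h : L -> F) :
  \sum_x avg C (C x) * h (C x) = \sum_x f x * h (C x).
Proof.
rewrite (partition_big C xpredT) //= [RHS](partition_big C xpredT) //=.
apply: eq_bigr => l _.
rewrite (eq_bigr (fun x => avg C (C x) * h l)); last by move=> x /eqP->.
rewrite [RHS](eq_bigr (fun x => f x * h l)); last by move=> x /eqP->.
by rewrite -!big_distrl /= sum_avg_class.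
Qed.

Lemma avg01 (L : finType) (C : X -> L) l : 0 <= avg C l <= 1.
Proof.
have [e0|n0] := eqVneq #|[set y | C y == l]| 0%N; first by rewrite /avg e0 invr0 mulr0 lexx ler01.
have p0 : 0 < #|[set y | C y == l]|%:R :> F by rewrite ltr0n lt0n.
rewrite /avg divr_ge0 ?ler0n ?sumr_ge0 //=; last by move=> x _; have /andP[] := f01 x.
rewrite ler_pdivrMr // mul1r -sum1_card natr_sum.
rewrite [leRHS](eq_bigl (fun y => C y == l)); last by move=> x; rewrite inE.
by apply: ler_sum => x _; have /andP[] := f01 x.
Qed.

Lemma energy_le (L : finType) (C : X -> L) : 0 <= energy C <= #|X|%:R.
Proof.
rewrite /energy sumr_ge0 => [|x _]; last exact: sqr_ge0.
rewrite -sum1_card natr_sum; apply: ler_sum => x _.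
by have /andP[h0 h1] := avg01 C (C x); rewrite expr_le1.
Qed.

(** Pythagoras: the coarse averages are the orthogonal projection of the fine ones. *)
Lemma energy_refine (L L' : finType) (C : X -> L) (C' : X -> L') (phi : L' -> L) :
  (forall x, C x = phi (C' x)) ->
  \sum_x (avg C' (C' x) - avg C (C x)) ^+ 2 = energy C' - energy C.
Proof.
move=> Cphi.
have e : \sum_x avg C' (C' x) * avg C (C x) = energy C.
  have := sum_avg C' (fun l => avg C (phi l)); have := sum_avg C (avg C).
  rewrite /energy => e1 e2; rewrite [RHS](eq_bigr (fun x => avg C (C x) * avg C (C x)));
      last by move=> x _; rewrite expr2.
  rewrite e1; transitivity (\sum_x f x * avg C (phi (C' x))); last by apply: eq_bigr => x _;
      rewrite Cphi.
  by rewrite -e2; apply: eq_bigr => x _; rewrite Cphi.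
rewrite (eq_bigr (fun x => avg C' (C' x) ^+ 2 + avg C (C x) ^+ 2 - 2 * (avg C' (C' x) * avg C (C
    x)))); last first.
  by move=> x _; ring.
rewrite big_split big_split /= -/(energy C') -/(energy C) sumrN -mulr_sumr e; ring.
Qed.

(* On a union of fine classes inside the coarse class [l], of mean at most half
   of [d <= avg C l], the fine and coarse averages differ by at least [d / 2]
   in quadratic mean. *)
Lemma energy_gain (L L' : finType) (C : X -> L) (C' : X -> L') (phi : L' -> L) (d : F) (B : pred L)
    (S : L -> pred L') :
  (forall x, C x = phi (C' x)) -> 0 <= d ->
  (forall l, B l -> d <= avg C l) ->
  (forall l l', S l l' -> phi l' = l) ->
  (forall l, B l -> \sum_(x | S l (C' x)) f x <= d / 2 * #|[set x | S l (C' x)]|%:R) ->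
  d ^+ 2 / 4 * \sum_(l | B l) #|[set x | S l (C' x)]|%:R <= energy C' - energy C.
Proof.
move=> Cphi d0 dB Sphi Sf; rewrite -(energy_refine Cphi).
rewrite [leRHS](partition_big C xpredT) //= mulr_sumr.
rewrite [leRHS](bigID B) /= -[leLHS]addr0; apply: lerD; last first.
  by apply: sumr_ge0 => l _; apply: sumr_ge0 => x _; apply: sqr_ge0.
apply: ler_sum => l Bl.
have SC x : S l (C' x) -> C x == l by move=> /Sphi e; rewrite Cphi e.
apply: (@le_trans _ _ (\sum_(x | S l (C' x)) (avg C' (C' x) - avg C (C x)) ^+ 2)); last first.
  rewrite [leRHS]big_mkcond [leLHS]big_mkcond /=; apply: ler_sum => x _.
  by case: ifP => [/SC->//|_]; case: ifP => // _; apply: sqr_ge0.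
have fE : \sum_(x | S l (C' x)) avg C' (C' x) = \sum_(x | S l (C' x)) f x.
  rewrite [LHS]big_mkcond [RHS]big_mkcond /=.
  transitivity (\sum_x avg C' (C' x) * (S l (C' x))%:R).
    by apply: eq_bigr => x _; case: ifP; rewrite ?mulr1 ?mulr0.
  rewrite (sum_avg C' (fun l' => (S l l')%:R)).
  by apply: eq_bigr => x _; case: ifP; rewrite ?mulr1 ?mulr0.
have sumc (a : F) : \sum_(x | S l (C' x)) a = a * #|[set x | S l (C' x)]|%:R.
  by rewrite mulr_natr -sumr_const; apply: eq_bigl => x; rewrite inE.
(* For a coarse mean of at least [d], the square is bounded below by a function that is affine in
   the fine mean, so that only the sum of the fine means matters; the bound comes from completing
   the square around [d / 2]. *)
apply: (@le_trans _ _ (\sum_(x | S l (C' x)) (d * (d - avg C' (C' x)) - d ^+ 2 / 4))).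
  rewrite big_split /= -mulr_sumr big_split /= sumrN fE sumrN !sumc.
  have := Sf l Bl; have : 0 <= #|[set x | S l (C' x)]|%:R :> F by rewrite ler0n.
  move: (#|_|%:R) (\sum_(x | _) _) => N s N0 hs.
  have : d * s <= d * (d / 2 * N) by apply: ler_wpM2l.
  by rewrite expr2 => ?; lra.
apply: ler_sum => x Sx; have := dB l Bl; rewrite -(eqP (SC x Sx)).
move: (avg C _) (avg C' _) => a b da.
have h1 : 0 <= (a - b - d / 2) ^+ 2 by apply: sqr_ge0.
have h2 : 0 <= d * (a - d) by rewrite mulr_ge0 // subr_ge0.
have -> : (b - a) ^+ 2 = (a - b - d / 2) ^+ 2 + d * (a - b) - d ^+ 2 / 4 by field.
have -> : d * (d - b) = d * (a - b) - d * (a - d) by ring.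
lra.
Qed.
End Energy.

Definition adj_val (F : realFieldType) (T : finType) (adj : rel T) (p : T * T) : F := (adj p.1 p.2)%:R.
Definition pair_color (T K : Type) (c : T -> K) (p : T * T) : K * K := (c p.1, c p.2).

(** Every bad pair gets a witness [W l], and the new colour of a vertex records its old class and
    the pairs whose first or second witness set contains it. With [d = 1 / (2 * D)] and witness sets
    of size at least [m / D], the gain is at least
    $\frac{1}{16D^2}\cdot\frac{1}{D^2}\cdot\frac{1}{8D}$ of [#|T| ^ 2]. *)
Lemma refine_step (F : realFieldType) (T K : finType) (adj : rel T) (c : T -> K) D m :
  (0 < D)%N ->
  let bad l := [&& #|fiber c l.1| == m, #|fiber c l.2| == m,
                 [exists q, irregular adj c D m l.1 l.2 q] &
                 (2 * D%:R)^-1 <= avg (adj_val F adj) (pair_color c) l] in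
  (#|T| ^ 2 < 8 * D * \sum_(l | bad l) m ^ 2)%N ->
  exists c' : T -> K * {set K * K} * {set K * K},
    energy (adj_val F adj) (pair_color c) + (128 * D%:R ^+ 5)^-1 * (#|T| ^ 2)%:R <=
    energy (adj_val F adj) (pair_color c').
Proof.
move=> D0 bad hbad; set f := adj_val F adj; set d : F := (2 * D%:R)^-1.
have Dr : 0 < D%:R :> F by rewrite ltr0n.
pose W l := odflt (finset.set0, finset.set0) [pick q | bad l && irregular adj c D m l.1 l.2 q].
pose c' u := (c u, [set l | u \in (W l).1], [set l | u \in (W l).2]).
exists c'.
pose phi (p : (K * {set K * K} * {set K * K}) * (K * {set K * K} * {set K * K})) :=
  (p.1.1.1, p.2.1.1).
pose S l (p : (K * {set K * K} * {set K * K}) * (K * {set K * K} * {set K * K})) :=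
  [&& phi p == l, l \in p.1.1.2 & l \in p.2.2].
have WP l : bad l -> irregular adj c D m l.1 l.2 (W l).
  move=> bl; rewrite /W; case: pickP => [q /andP[]//|no].
  by have /and4P[_ _ /existsP[q iq] _] := bl; have := no q; rewrite bl iq.
have WS l : (W l).1 \subset fiber c l.1 /\ (W l).2 \subset fiber c l.2.
  rewrite /W; case: pickP => [q /andP[_ /and5P[? ? _ _ _]]//|_ /=]; by rewrite !sub0set.
have SE l x : S l (pair_color c' x) = (x \in finset.setX (W l).1 (W l).2).
  case: x => x y; rewrite /S /phi /= !inE /=; have [/subsetP s1 /subsetP s2] := WS l.
  apply/and3P/andP => [[_ -> ->]//|[x1 y2]]; split=> //.
  by move: (s1 _ x1) (s2 _ y2); rewrite !inE => /eqP-> /eqP->; case: (l).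
have cS l : #|[set x | S l (pair_color c' x)]| = (#|(W l).1| * #|(W l).2|)%N.
  by rewrite -cardsX; apply: eq_card => x; rewrite inE SE.
have gain : d ^+ 2 / 4 * \sum_(l | bad l) #|[set x | S l (pair_color c' x)]|%:R <=
    energy f (pair_color c') - energy f (pair_color c).
  apply: (energy_gain (phi := phi) (S := S)) => //.
  - by rewrite /d invr_ge0 mulr_ge0 // ltW.
  - by move=> l /and4P[].
  - by move=> l l' /and3P[/eqP].
  move=> l bl; rewrite cS (eq_bigl (mem (finset.setX (W l).1 (W l).2))); last exact: SE.
  have -> : \sum_(x in finset.setX (W l).1 (W l).2) f x = (edge_count adj (W l).1 (W l).2)%:R.
    rewrite /edge_count -sum1_card natr_sum [RHS]big_mkcond [LHS]big_mkcond /=.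
    by apply: eq_bigr => x _; rewrite !inE /f /adj_val; case: (_ && (x.2 \in _)) => //=;
        case: (adj _ _).
  have /and5P[_ _ _ _] := WP l bl; rewrite -(ltr_nat F) natrM [(4 * D)%:R]natrM => lt.
  have -> : d / 2 = (4 * D%:R)^-1.
    by rewrite /d; field; rewrite lt0r_neq0.
  by rewrite mulrC ler_pdivlMr ?ltW // mulr_gt0 // ltr0n.
have lower : (#|T| ^ 2 <= 8 * D ^ 3 * \sum_(l | bad l) #|[set x | S l (pair_color c' x)]|)%N.
  apply: leq_trans (ltnW hbad) _; rewrite [(D ^ 3)%N]expnS mulnA -[leqRHS]mulnA leq_mul2l;
      apply/orP; right.
  rewrite big_distrr /=; apply: leq_sum => l bl; rewrite cS.
  have /and5P[_ _ w1 w2 _] := WP l bl.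
  by have := leq_mul w1 w2; rewrite mulnACA !mulnn.
rewrite -lerBrDl; apply: le_trans gain.
move: lower; rewrite -(ler_nat F) natrM natr_sum [(8 * _)%:R]natrM !natrX.
move: (\sum_(l | _) _) (#|T|%:R ^+ 2) => s N le.
have -> : d ^+ 2 / 4 * s = (128 * D%:R ^+ 5)^-1 * (8 * D%:R ^+ 3 * s).
  by rewrite /d; field; rewrite lt0r_neq0.
by apply: ler_wpM2l; rewrite ?invr_ge0 ?mulr_ge0 ?exprn_ge0 ?(ltW Dr).
Qed.

(* Here [j] bounds the number of energy increments still possible.  The type of
   colours grows at each step, hence the quantification over [K] inside. *)
Lemma regularity_induction (F : realFieldType) D j : (0 < D)%N -> forall K : finType,
  exists Q, forall (T : finType) (adj : rel T) (c : T -> K), symmetric adj ->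
    (Q <= #|T|)%N -> (0 < #|T|)%N ->
    (1 - j%:R * (128 * D%:R ^+ 5)^-1) * (#|T| ^ 2)%:R <
      energy (adj_val F adj) (pair_color c) ->
    regular_partition adj D Q.
Proof.
move=> D0; have Dr : 0 < D%:R :> F by rewrite ltr0n.
elim: j => [|j IH] K.
  exists 0%N => T adj c _ _ _; rewrite mul0r subr0 mul1r ltNge.
  have f01 x : 0 <= adj_val F adj x <= 1 by rewrite /adj_val; case: (adj _ _); rewrite ?lexx ?ler01.
  by have /andP[_] := energy_le f01 (pair_color c); rewrite card_prod mulnn => ->.
pose q := (8 * D * #|K|)%N; pose K1 : finType := (K * 'I_(16 * D * #|K|).+1)%type.
have [Q2 hQ2] := IH (K1 * {set K1 * K1} * {set K1 * K1})%type.
pose Q1 := maxn (2 * q).+1 #|K1|.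
exists (maxn Q1 Q2) => T adj c adjC leQ T0 hE.
have mono Q Q' : (Q <= Q')%N -> regular_partition adj D Q -> regular_partition adj D Q'.
  move=> leQQ [K' [c' [m [R [[h1 h2 h3] ? ? ? ?]]]]]; exists K', c', m, R; split=> //; split=> //.
    exact: leq_trans leQQ.
  by apply: leq_trans h3 _; rewrite leq_mul2r leQQ orbT.
have K0 : (0 < #|K|)%N by have /card_gt0P[v _] := T0; apply/card_gt0P; exists (c v).
have q0 : (0 < q)%N by rewrite !muln_gt0 D0 K0.
have qT : (q <= #|T|)%N by move: leQ; rewrite /Q1 !geq_max => /andP[/andP[+ _] _]; clear; lia.
have [c0 [cE c0m]] := chunk c D0 qT T0; rewrite -/q in c0m.
set m := (#|T| %/ q)%N in c0m.
have m0 : (0 < m)%N by rewrite divn_gt0.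
have f01 x : 0 <= adj_val F adj x <= 1 by rewrite /adj_val; case: (adj _ _); rewrite ?lexx ?ler01.
have E0 : energy (adj_val F adj) (pair_color c) <= energy (adj_val F adj) (pair_color c0).
  rewrite -subr_ge0 -(@energy_refine F _ _ _ _ _ (pair_color c0) (fun p => (p.1.1, p.2.1))).
    by apply: sumr_ge0 => x _; apply: sqr_ge0.
  by move=> x; rewrite /pair_color /= -!cE.
have := @refine_step F T _ adj c0 D m D0.
set bad := (fun l => _) => /=.
have [hb /(_ isT)[c' hc']|hb _] := ltnP (#|T| ^ 2) (8 * D * \sum_(l | bad l) m ^ 2).
  apply: (mono Q2); first by rewrite leq_maxr.
  apply: (hQ2 T adj c') => //; first by apply: leq_trans leQ; rewrite leq_maxr.
  apply: lt_le_trans hc'; move: hE E0.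
  by rewrite -natr1; move: (energy _ _) (energy _ _) (_^-1) (_%:R) => a b e N; lra.
apply: (mono Q1); first by rewrite leq_maxl.
pose irr i j := [exists q, irregular adj c0 D m i j q].
(* Density is implied by [~~ irr i j]: a sparse pair of clusters of size [m] is its own witness. *)
pose R i j := [&& #|fiber c0 i| == m, #|fiber c0 j| == m & ~~ irr i j].
have irrC i i' : irr i i' = irr i' i.
  by apply/existsP/existsP => -[p]; rewrite irregularC // => h; eexists; exact: h.
exists K1, c0, m, R; split.
- split=> //; first by rewrite leq_maxr.
  apply: leq_trans (_ : (2 * q) * m <= _)%N; last by rewrite leq_mul2r /Q1 leq_max leqnSn orbT.
  have : (#|T| < m.+1 * q)%N by rewrite ltn_ceil.
  by move: m0; clear; nia.
- by move=> i i'; rewrite /R irrC; apply/and3P/and3P => -[].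
- by move=> i i' /and3P[/eqP].
- move=> i i' A B /and3P[_ _ nirr] sA sB mA mB; rewrite leqNgt; apply: contra nirr => lt.
  by apply/existsP; exists (A, B); apply/and5P.
set f := adj_val F adj in bad hb *.
set d : F := (2 * D%:R)^-1 in bad hb *.
pose small : {set T} := [set u | #|fiber c0 (c0 u)| != m].
(* Pairs are lost through a cluster of wrong size at either end, through dense irregular pairs, or
   through sparse pairs. The shares are at most three times [1 / (8 * D)] and once [1 / (2 * D)]. *)
pose X1 := finset.setX small [set: T]; pose X2 := finset.setX [set: T] small.
pose X3 : {set T * T} := [set p | bad (pair_color c0 p)].
pose X4 : {set T * T} := [set p | adj p.1 p.2 && (avg f (pair_color c0) (pair_color c0 p) < d)].
have cov : [set p | adj p.1 p.2 && ~~ R (c0 p.1) (c0 p.2)] \subset X1 :|: X2 :|: X3 :|: X4.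
  apply/subsetP => -[x y]; rewrite !inE /= !andbT /R /bad /pair_color /=.
  case: (adj x y) => //=; case: (#|fiber c0 (c0 x)| == m) => //=.
  case: (#|fiber c0 (c0 y)| == m) => //=; rewrite negbK /irr => -> /=.
  by case: ltP.
have c1 : (8 * D * #|X1| <= #|T| ^ 2)%N.
  by rewrite cardsX cardsT mulnA -mulnn leq_mul2r c0m orbT.
have c2 : (8 * D * #|X2| <= #|T| ^ 2)%N.
  by rewrite cardsX cardsT [(#|T| * _)%N]mulnC mulnA -mulnn leq_mul2r c0m orbT.
have c3 : (8 * D * #|X3| <= #|T| ^ 2)%N.
  apply: leq_trans hb; rewrite leq_mul2l; apply/orP; right.
  rewrite -sum1_card (partition_big (pair_color c0) bad) /=; last by move=> p; rewrite inE.
  apply: leq_sum => -[i i'] bl; have /and3P[/eqP e1 /eqP e2 _] := bl.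
  rewrite /= in e1 e2; rewrite sum1dep_card;
      apply: leq_trans (_ : #|fiber (pair_color c0) (i, i')| <= _)%N.
    by apply: subset_leq_card; apply/subsetP => p; rewrite !inE => /andP[].
  by rewrite card_fiber_pair e1 e2 mulnn.
have c4 : (2 * D * #|X4| <= #|T| ^ 2)%N.
  have : #|X4|%:R <= d * (#|T| ^ 2)%:R.
    have -> : #|X4|%:R = \sum_p f p * (avg f (pair_color c0) (pair_color c0 p) < d)%R%:R.
      rewrite -sum1_card natr_sum [LHS]big_mkcond /=; apply: eq_bigr => p _.
      by rewrite inE /f /adj_val; case: (adj _ _); case: (_ < d); rewrite ?mulr0 ?mul0r ?mulr1.
    rewrite -(sum_avg f (pair_color c0) (fun l => (avg f (pair_color c0) l < d)%R%:R)).
    apply: (@le_trans _ _ (\sum_(p : T * T) d)); last first.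
      by rewrite sumr_const card_prod mulnn mulr_natr.
    apply: ler_sum => p _; case: ltP => [/ltW le|_]; rewrite ?mulr1 ?mulr0 //.
    by rewrite /d invr_ge0 mulr_ge0 // ltW.
  rewrite /d mulrC ler_pdivlMr ?mulr_gt0 // -(ler_nat F) natrM natrM => le.
  by rewrite mulrC.
have u2 (A B : {set T * T}) : (#|A :|: B| <= #|A| + #|B|)%N by rewrite cardsU leq_subr.
have le4 : (#|[set p | adj p.1 p.2 && ~~ R (c0 p.1) (c0 p.2)]| <= #|X1| + #|X2| + #|X3| + #|X4|)%N.
  apply: leq_trans (subset_leq_card cov) _; apply: leq_trans (u2 _ _) _; rewrite leq_add2r.
  by apply: leq_trans (u2 _ _) _; rewrite leq_add2r u2.
rewrite -(leq_pmul2l (isT : 0 < 8)%N) mulnA; apply: leq_trans (leq_mul (leqnn _) le4) _.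
move: c1 c2 c3 c4; clear.
by move: #|X1| #|X2| #|X3| #|X4| (#|T| ^ 2)%N => x1 x2 x3 x4 N; lia.
Qed.

(** Starting from a single class, [128 * D ^ 5 + 1] increments put the initial energy threshold
    below 0. *)
Lemma regularity_over (F : realFieldType) (D : nat) : (0 < D)%N ->
    exists Q, forall (T : finType) (adj : rel T),
  symmetric adj -> (Q <= #|T|)%N -> regular_partition adj D Q.
Proof.
move=> D0; have [Q hQ] := regularity_induction F (128 * D ^ 5).+1 D0 unit.
exists Q.+1 => T adj adjC leQ.
have T0 : (0 < #|T|)%N by apply: leq_trans leQ.
have [|//||K [c [m [R [[h1 h2 h3] ? ? ? ?]]]]] := hQ T adj (fun=> tt) adjC.
- exact: ltnW.
- have f01 x : 0 <= adj_val F adj x <= 1 by rewrite /adj_val; case: (adj _ _); rewrite ?lexx ?ler01.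
  have /andP[+ _] := energy_le f01 (pair_color (fun=> tt : unit)).
  move=> e0; apply: lt_le_trans e0.
  have D5 : 0 < 128 * D%:R ^+ 5 :> F by rewrite mulr_gt0 ?exprn_gt0 ?ltr0n.
  rewrite pmulr_llt0 ?ltr0n ?expn_gt0 ?T0 // subr_lt0 ltr_pdivlMr // mul1r.
  by rewrite -natrX -natrM ltr_nat ltnSn.
exists K, c, m, R; split=> //; split=> //; first exact: leqW.
by apply: leq_trans h3 _; rewrite leq_mul2r leqnSn orbT.
Qed.

Lemma regularity (D : nat) : (0 < D)%N -> exists Q, forall (T : finType) (adj : rel T),
  symmetric adj -> (Q <= #|T|)%N -> regular_partition adj D Q.
Proof. exact: (@regularity_over rat). Qed.

Local Close Scope ring_scope.

(** * Transference from the dense graph *)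

Definition edge_rel (T : finType) (G : sgraph T) : rel T := fun x y => [set x; y] \in edges G.

Lemma edge_relC (T : finType) (G : sgraph T) : symmetric (edge_rel G).
Proof. by move=> x y; rewrite /edge_rel setUC. Qed.

Lemma card_edge (T : finType) (G : sgraph T) e : e \in edges G -> #|e| = 2.
Proof. by move=> eG; have /forall_inP/(_ e eG)/eqP := valP G. Qed.

Lemma cycle_nth (T : Type) (e : rel T) x0 p j :
  cycle e p -> j < size p -> e (nth x0 p j) (nth x0 p (j.+1 %% size p)).
Proof.
case: p => // x p /= /(pathP x0)/(_ j); rewrite size_rcons => h lt; have := h lt.
rewrite -rcons_cons nth_rcons /= lt nth_rcons.
move: lt; rewrite ltnS leq_eqVlt => /orP[/eqP ->|lt].
  by rewrite ltnn eqxx modnn.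
by rewrite lt modn_small.
Qed.

Lemma cycle_copy (T : finType) (G : sgraph T) t p :
  3 <= t -> uniq p -> cycle (edge_rel G) p -> size p = t -> contains_copy G (cycle_graph t).
Proof.
move=> t3 up cp sp; case ep : p => [|x0 p']; first by move: sp t3; rewrite ep => <-.
apply/existsP; exists [ffun i : 'I_t => nth x0 p i]; apply/andP; split.
  apply/injectiveP => i j; rewrite !ffunE => /eqP; rewrite nth_uniq ?sp ?ltn_ord //.
  by move/eqP/val_inj.
apply/forall_inP => e; rewrite inE => /andP[/imsetP[i _ ->] _].
rewrite imsetU1 imset_set1 !ffunE /=.
have ip : i < size p by rewrite sp.
by have := cycle_nth x0 cp ip; rewrite sp.
Qed.

Lemma copy_cycle (T : finType) (G : sgraph T) t : 3 <= t -> contains_copy G (cycle_graph t) ->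
  exists f : nat -> T, [/\ forall j, f (j + t) = f j, forall j, edge_rel G (f j) (f j.+1) &
    injective (fun i : 'I_t => f i)].
Proof.
move=> t3 /existsP[f /andP[/injectiveP injf /forall_inP cf]].
have t0 : 0 < t by apply: leq_trans t3.
exists (fun j => f (Ordinal (ltn_pmod j t0))); split.
- by move=> j; congr (f _); apply: val_inj; rewrite /= modnDr.
- move=> j; set i := Ordinal _.
  have -> : Ordinal (ltn_pmod j.+1 t0) = ordS i.
    by apply: val_inj; rewrite /= -addn1 -modnDml addn1.
  have eE : f @: [set i; ordS i] = [set f i; f (ordS i)] by rewrite imsetU1 imset_set1.
  rewrite /edge_rel -eE; apply: cf; rewrite inE; apply/andP; split; first by apply/imsetP; exists i.
  rewrite cards2 eqSS eqb1; apply/eqP => /(congr1 val) /= ej.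
  have : i = i.+1 %% t :> nat by [].
  have := ltn_ord i; move: (nat_of_ord i) => x xt.
  have [lt|ge] := ltnP x.+1 t; first by rewrite modn_small //; lia.
  have -> : x.+1 = t by lia.
  by rewrite modnn; lia.
move=> i j /injf /(congr1 val) /=; rewrite !modn_small // => e; exact: val_inj.
Qed.

Lemma exp_dominates Z : exists L, forall l, L <= l -> Z * (l + Z) <= 2 ^ l.
Proof.
have sq l : 4 <= l -> l ^ 2 <= 2 ^ l.
  elim: l => // l IH; rewrite leq_eqVlt => /orP[/eqP <-//|l4].
  rewrite ltnS in l4; rewrite [2 ^ _]expnS; have := IH l4;
      have : 4 * l <= l * l by rewrite leq_mul2r l4 orbT.
  by rewrite -!mulnn; move: (2 ^ l) l4 => x; clear; nia.
exists (2 * Z + 4) => l h; apply: leq_trans (sq l _); last by lia.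
by rewrite -mulnn; move: h; clear; nia.
Qed.

Lemma extremal_copy n (U : finType) (H : sgraph U) (G : sgraph 'I_n) :
  extremal_number n H < num_edges G -> contains_copy G H.
Proof.
by apply: contraTT => nH; rewrite -leqNgt; apply: (@leq_bigmax_cond _ _ (@num_edges _) G nH).
Qed.

Definition spanning_sub (T : finType) (G : sgraph T) (good : rel T) : {set {set T}} :=
  [set e in edges G | [exists p : T * T, (e == [set p.1; p.2]) && good p.1 p.2]].

Lemma spanning_subP (T : finType) (G : sgraph T) (good : rel T) :
  [forall e in spanning_sub G good, #|e| == 2].
Proof. by apply/forall_inP => e; rewrite inE => /andP[/card_edge->]. Qed.

Definition restrict_edges (T : finType) (G : sgraph T) (good : rel T) : sgraph T :=
  exist _ (spanning_sub G good) (spanning_subP G good).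

Lemma edge_rel_restrict (T : finType) (G : sgraph T) (good : rel T) x y :
  symmetric good -> edge_rel (restrict_edges G good) x y -> edge_rel G x y && good x y.
Proof.
move=> goodC; rewrite /edge_rel inE => /andP[xy /existsP[[u v] /andP[/eqP /= e g]]].
rewrite xy; have := card_edge xy; rewrite cards2; case: (x =P y) => // nxy _ /=.
have : x \in [set u; v] by rewrite -e !inE eqxx.
have : y \in [set u; v] by rewrite -e !inE eqxx orbT.
rewrite !inE => /orP[]/eqP ey /orP[]/eqP ex; subst x y => //.
by rewrite goodC.
Qed.

Lemma num_edges_restrict (T : finType) (G : sgraph T) (good : rel T) :
  num_edges G <= num_edges (restrict_edges G good) +
    #|[set p : T * T | edge_rel G p.1 p.2 && ~~ good p.1 p.2]|.
Proof.
set bad := [set p | _]; pose f (p : T * T) := [set p.1; p.2].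
apply: leq_trans (_ : #|spanning_sub G good| + #|f @: bad| <= _); last first.
  by rewrite leq_add2l leq_imset_card.
apply: leq_trans (_ : #|spanning_sub G good :|: f @: bad| <= _); last by rewrite cardsU leq_subr.
apply/subset_leq_card/subsetP => e eG.
have /cards2P[x [y [_ exy]]] : #|e| == 2 by rewrite (card_edge eG).
rewrite in_setU; have [g|ng] := boolP (good x y).
  by rewrite inE eG; apply/orP; left; apply/existsP; exists (x, y); rewrite exy eqxx.
apply/orP; right; apply/imsetP; exists (x, y) => //.
by rewrite inE /= ng /edge_rel -exy eG.
Qed.

Section Areas.
Variables (T K : finType) (c : T -> K) (m s : nat).

Definition area_index v := if class_index c v < 6 * s then class_index c v %/ s else 6.
(** Area 5 is reserved, so the copy in the dense graph avoids it, yet it belongs to the bulk: this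
    is the slack of [s] vertices per cluster. *)
Definition reserved v := class_index c v < 6 * s.

Hypotheses (s0 : 0 < s) (sm : 6 * s <= m).

Lemma card_area h x : #|fiber c h| = m -> x < 5 -> #|area c area_index h x| = s.
Proof.
move=> fm x5; rewrite -[RHS](@count_iota_interval (x * s) s m); last by nia.
rewrite -fm -card_class_index; apply: eq_card => v; rewrite !inE; congr (_ && _).
rewrite /area_index; case: (ltnP (class_index c v)) => lt.
  by rewrite eqn_leq -ltnS ltn_divLR // leq_divRL // andbC mulSn addnC.
have -> : (6 == x) = false by apply/eqP; lia.
by apply/esym/negP; nia.
Qed.

Lemma card_bulk h : #|fiber c h| = m -> #|bulk c area_index h| = m - 5 * s.
Proof.
move=> fm; rewrite -[RHS]count_iota_ge -fm -card_class_index.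
apply: eq_card => v; rewrite !inE; congr (_ && _); rewrite /area_index.
by case: (ltnP (class_index c v)) => lt; [rewrite leq_divRL|move: lt; clear; lia].
Qed.

Lemma card_unreserved h : #|fiber c h| = m -> #|[set v | (c v == h) && ~~ reserved v]| = m - 6 * s.
Proof.
move=> fm; rewrite -[RHS]count_iota_ge -fm -card_class_index.
by apply: eq_card => v; rewrite !inE /reserved -leqNgt.
Qed.

Lemma card_reserved (full : pred K) : (forall h, full h -> #|fiber c h| = m) ->
  #|[set v | full (c v) && reserved v]| * m <= 6 * s * #|T|.
Proof.
move=> fm.
have part (P : pred T) : \sum_(v | full (c v) && P v) 1 =
    \sum_(h | full h) #|[set v | (c v == h) && P v]|.
  rewrite (partition_big c full) /=; last by move=> v /andP[].
  apply: eq_bigr => h fh; rewrite -sum1_card; apply: eq_bigl => v; rewrite inE.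
  by case: eqP => [->|_]; rewrite ?fh ?andbT ?andbF.
rewrite -sum1dep_card part big_distrl /=.
apply: leq_trans (_ : \sum_(h | full h) 6 * s * m <= _).
  apply: leq_sum => h fh; rewrite leq_mul2r; apply/orP; right.
  have := cardsID [set v | reserved v] (fiber c h).
  have -> : fiber c h :&: [set v | reserved v] = [set v | (c v == h) && reserved v].
    by apply/setP => v; rewrite !inE.
  have -> : fiber c h :\: [set v | reserved v] = [set v | (c v == h) && ~~ reserved v].
    by apply/setP => v; rewrite !inE andbC.
  by rewrite card_unreserved ?fm //; lia.
rewrite -big_distrr leq_mul2l /=; apply/orP; right.
rewrite (eq_bigr (fun h => #|[set v | (c v == h) && true]|)); last first.
  by move=> h fh; rewrite -(fm h fh); apply: eq_card => v; rewrite !inE andbT.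
by rewrite -part sum1dep_card max_card.
Qed.
End Areas.

(** The deterministic core. An integer [b] stands for $1/\beta$, and randomness enters only through
    the hypothesis on [F]. The last hypothesis is the lower bound on [t], expressed through the
    depth of a tree with at most [n] leaves. *)
Lemma joined_contains_cycle b k : 0 < b -> 1 < k -> exists D N B, forall n t (G F : sgraph 'I_n),
  N <= n -> 3 <= t ->
  b * extremal_number n (cycle_graph t) + 'C(n, 2) <= b * num_edges G ->
  (forall A B : {set 'I_n}, n ^ 2 <= D * edge_count (edge_rel G) A B ->
     exists x y, [/\ x \in A, y \in B & edge_rel F x y]) ->
  (forall l, k ^ l <= n -> 3 * l + B <= t) ->
  contains_copy F (cycle_graph t).
Proof.
(* An area has [S * a] vertices: [(2 * k + 6) * a] to grow a tree and [3 * a] for vertices already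
   used. [D1] keeps the reserved part of a cluster below [6 / (100 * b)]; the factor [k ^ 2] pays
   for rounding [a] down to a power of [k ^ 2]. *)
move=> b0 k1; pose S := 2 * k + 9; pose D1 := 100 * b * S; pose D := k ^ 2 * D1.
have k2 : 1 < k ^ 2 by rewrite -mulnn; move: k1; clear; nia.
have D10 : 0 < D1 by rewrite /D1 /S !muln_gt0 b0 addnS.
have D0 : 0 < D by rewrite muln_gt0 D10 andbT; move: k2; clear; lia.
have [Q hQ] := regularity D0.
pose Z := Q ^ 2 + 2 * Q + 3.
have [L0 hL0] := exp_dominates Z.
(* Sets of size at least [a] have at least [n / (Q * D)] vertices, and large subpairs have density
   at least [1 / (4 * D)], which gives the first witness. The second forces [L0 < l]; the third
   bounds [4 * #|K| + 5]. *)
exists (Q ^ 2 * D ^ 2 * (4 * D)), (maxn (maxn Q 2) (Q * D * k ^ L0.+1)), (4 * Q + 5).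
move=> n t G F; rewrite !geq_max => /andP[/andP[Qn n2] nL] t3 hG hF ht.
have [||K [c [m [R [[KQ m0 nQm] RC Rm Rdense Rloss]]]]] := hQ 'I_n (edge_rel G).
- exact: edge_relC.
- by rewrite card_ord.
rewrite card_ord in nQm Rloss.
have Q0 : 0 < Q.
  by rewrite lt0n; apply: contraTneq n2 => q0; move: nQm; rewrite q0 mul0n leqn0 => /eqP->.
have Dkm : D * k ^ L0.+1 <= m by rewrite -(leq_pmul2l Q0) mulnA (leq_trans nL).
have mD1 : 0 < m %/ D1.
  rewrite divn_gt0 //; apply: leq_trans Dkm; rewrite mulnAC leq_pmull // muln_gt0 !expn_gt0.
  by move: k1; clear; lia.
(* Taking [a] to be an exact even power of [k] makes all tree depths equal to [l]. *)
pose l := 2 * trunc_log (k ^ 2) (m %/ D1); pose a := k ^ l.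
have aE : a = (k ^ 2) ^ trunc_log (k ^ 2) (m %/ D1) by rewrite -expnM.
have a0 : 0 < a by rewrite expn_gt0; lia.
have aD1 : D1 * a <= m by rewrite mulnC -leq_divRL // aE trunc_logP.
have mDa : m < D * a.
  have := trunc_log_ltn (m %/ D1) k2; rewrite expnS -aE ltn_divLR // => lt.
  by apply: leq_trans lt _; rewrite mulnAC.
have Ll : L0 < l.
  rewrite -(ltn_exp2l _ _ k1) -/a -(ltn_pmul2l D0); apply: leq_ltn_trans mDa.
  by apply: leq_trans Dkm; rewrite leq_mul2l leq_pexp2l ?orbT //; move: k1; clear; lia.
pose s := S * a.
have S9 : 9 <= S by rewrite leq_addl.
have s0 : 0 < s by rewrite muln_gt0 a0 andbT; move: S9; clear; lia.
have sD1 : 100 * b * s <= m by apply: leq_trans aD1; rewrite /s /D1 mulnA.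
have s12 : 12 * s <= m by apply: leq_trans sD1; rewrite leq_mul2r; move: b0; clear; lia.
have s6 : 6 * s <= m by apply: leq_trans s12; rewrite leq_mul2r orbT.
pose full h := [exists j, R h j].
have fm h : full h -> #|fiber c h| = m by move=> /existsP[j /Rm].
pose res := reserved c s.
pose good x y := [&& R (c x) (c y), ~~ res x & ~~ res y].
have goodC : symmetric good by move=> x y; rewrite /good RC [X in _ && X]andbC.
pose G' := restrict_edges G good.
have resW : 100 * b * #|[set v | full (c v) && res v]| <= 6 * n.
  have := card_reserved s0 s6 fm; rewrite card_ord -/res; move: #|_| => x hx.
  rewrite -(leq_pmul2l s0); apply: leq_trans (_ : x * m <= _); last first.
    by apply: leq_trans hx _; rewrite mulnA [s * 6]mulnC.
  by rewrite mulnA [s * _]mulnC mulnC leq_mul2l sD1 orbT.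
(* The 13 is 1 for the pairs outside [R] plus 6 for each end that may be reserved. *)
have few_bad : 100 * b * #|[set p : 'I_n * 'I_n | edge_rel G p.1 p.2 && ~~ good p.1 p.2]| <= 13 * n ^ 2.
  pose X1 := [set p : 'I_n * 'I_n | edge_rel G p.1 p.2 && ~~ R (c p.1) (c p.2)].
  pose W := [set v | full (c v) && res v].
  have cov : [set p : 'I_n * 'I_n | edge_rel G p.1 p.2 && ~~ good p.1 p.2] \subset
      X1 :|: (setX W setT :|: setX setT W).
    apply/subsetP => -[x y]; rewrite !inE /good /= => /andP[-> /=]; rewrite andbT.
    case: (boolP (R (c x) (c y))) => //= Rxy.
    have -> : full (c x) by apply/existsP; exists (c y).
    have -> : full (c y) by apply/existsP; exists (c x); rewrite RC.
    by rewrite negb_and !negbK.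
  have c1 : 100 * b * #|X1| <= n ^ 2.
    apply: leq_trans Rloss; rewrite leq_mul2r; apply/orP; right.
    apply: leq_trans (_ : D1 <= _); first by rewrite leq_pmulr // /S; clear; lia.
    by rewrite leq_pmull // expn_gt0; move: k1; clear; lia.
  have c2 : #|setX W setT :|: setX setT W| <= #|W| * n + #|W| * n.
    rewrite cardsU; apply: leq_trans (leq_subr _ _) _.
    by rewrite !cardsX cardsT card_ord [n * _]mulnC.
  have := subset_leq_card cov; have : #|X1 :|: (setX W setT :|: setX setT W)| <= #|X1| + (#|W| * n
      + #|W| * n).
    by rewrite cardsU; apply: leq_trans (leq_subr _ _) _; rewrite leq_add2l.
  move=> h2 h1; have h := leq_trans h1 h2.
  apply: leq_trans (leq_mul (leqnn (100 * b)) h) _.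
  have : 100 * b * #|W| * n <= 6 * n * n by rewrite leq_mul2r resW orbT.
  move: c1; rewrite -/W -!mulnn; clear; move: #|X1| #|W| => x1 w; nia.
have G'copy : contains_copy G' (cycle_graph t).
  apply: extremal_copy; rewrite -(ltn_pmul2l b0).
  have bad_lt : b * #|[set p : 'I_n * 'I_n | edge_rel G p.1 p.2 && ~~ good p.1 p.2]| < 'C(n, 2).
    rewrite bin2; move: few_bad n2; move: #|_| => x; clear => h n2.
    suff lt : 13 * n ^ 2 < 100 * (n * n.-1)./2.
      by rewrite -(ltn_pmul2l (isT : 0 < 100)) mulnA; apply: leq_ltn_trans lt.
    have : 2 * (n * n.-1)./2 = n * n.-1 by rewrite mul2n even_halfK // oddM;
        case: n n2 {h} => //= n _; rewrite andNb.
    by case: n n2 {h} => // n n2 /=; rewrite -mulnn; nia.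
  have := num_edges_restrict G good : num_edges G <= num_edges G' +
    #|[set p : 'I_n * 'I_n | edge_rel G p.1 p.2 && ~~ good p.1 p.2]|.
  rewrite -(leq_pmul2l b0) mulnDr; move: bad_lt hG; move: (b * #|_|) => x; clear; lia.
have [f [fper fadj finj]] := copy_cycle t3 G'copy.
pose w j := c (f j).
have fgood j : good (f j) (f j.+1) by have /andP[] := edge_rel_restrict goodC (fadj j).
have wR j : R (w j) (w j.+1) by have /and3P[] := fgood j.
have mn : m <= n.
  rewrite -(fm (w 0)); last by apply/existsP; exists (w 1).
  by apply: leq_trans (max_card _) _; rewrite card_ord.
have Rjoined i j : R i j -> joined (edge_rel F) a (fiber c i) (fiber c j).
  move=> Rij A B sA sB aA aB; apply: hF.
  have mDle (X : {set 'I_n}) : a <= #|X| -> m <= D * #|X|.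
    by move=> aX; apply: leq_trans (ltnW mDa) _; rewrite leq_mul2l aX orbT.
  have := Rdense i j A B Rij sA sB (mDle A aA) (mDle B aB).
  move=> h; apply: leq_trans (_ : Q ^ 2 * D ^ 2 * (#|A| * #|B|) <= _).
    have h1 (X : {set 'I_n}) : a <= #|X| -> n <= Q * (D * #|X|).
      by move=> aX; apply: leq_trans nQm _; rewrite leq_mul2l (mDle X aX) orbT.
    by have := leq_mul (h1 A aA) (h1 B aB); rewrite -!mulnn; move: #|A| #|B| => x y; clear; nia.
  by rewrite -[leqRHS]mulnA leq_mul2l; apply/orP; right; rewrite [leqRHS]mulnC.
have Zle : (#|K| ^ 2 + 3) * (l + 2 * #|K| + 3) <= a.
  apply: leq_trans (_ : 2 ^ l <= _); last by rewrite leq_exp2r // (leq_trans _ Ll).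
  apply: leq_trans (hL0 l (ltnW Ll)); apply: leq_mul.
    by apply: leq_trans (_ : Q ^ 2 + 3 <= _); [rewrite leq_add2r leq_exp2r|rewrite /Z; clear; lia].
  by move: KQ; rewrite /Z; clear; lia.
have lt_ : 3 * l + 4 * #|K| + 5 <= t.
  have al : k ^ l <= n by apply: leq_trans mn; apply: leq_trans aD1; rewrite leq_pmull.
  apply: leq_trans (ht l al); rewrite -addnA leq_add2l leq_add2r leq_mul2l KQ orbT //.
have [||||||p [up cp sp]] := @closed_walk_cycle 'I_n (edge_rel F) K c R (area_index c s) a k l t w wR
    (@edge_relC _ F) RC (erefl a) _ _ k1 Rjoined _ m s Zle (erefl s) s12 lt_ _ _ _.
- by rewrite /l oddM.
- by move: Ll; clear; case: l.
- by move=> j; rewrite /w fper.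
- by move=> h x /fm fh x5; exact: (card_area s0 s6 fh x5).
- by move=> h /fm fh; exact: (card_bulk s0 fh).
(* The walk comes from a genuine copy on distinct unreserved vertices, so it visits [h] at most as
   often as [h] has unreserved vertices. If it visits [h] at all, then [h] is full and has size
   [m]. *)
- move=> h; case: (pickP (fun j : 'I_t => w j == h)) => [j0 /eqP e0|no]; last first.
    by rewrite (_ : [set j : 'I_t | w j == h] = set0) ?cards0 //; apply/setP => j; rewrite !inE no.
  have fh : #|fiber c h| = m by rewrite -e0; apply: fm; apply/existsP; exists (w j0.+1).
  rewrite -(card_unreserved s fh) -(card_imset _ finj); apply/subset_leq_card/subsetP => v.
  case/imsetP => j; rewrite inE => /eqP wj ->; rewrite inE -wj eqxx /=.
  by have /and3P[] := fgood j.
exact: cycle_copy sp.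
Qed.

(** * The random subgraph *)

(* Imported only here because [classical_sets] shadows many [finset] lemmas. *)
From mathcomp Require Import all_classical all_reals all_analysis.
Import numFieldNormedType.Exports.
Local Open Scope ring_scope.

Definition edges_between (T : finType) (G : sgraph T) (A B : {set T}) : {set {set T}} :=
  [set e in edges G | [exists p : T * T, [&& p.1 \in A, p.2 \in B & e == [set p.1; p.2]]]].

(** An edge has two orientations: [o] picks one of them and [o'] is its reverse. *)
Lemma edge_count_le (T : finType) (G : sgraph T) (A B : {set T}) :
  (edge_count (edge_rel G) A B <= 2 * #|edges_between G A B|)%N.
Proof.
rewrite /edge_count; have [->|[p0 _]] := set_0Vmem [set p in finset.setX A B | edge_rel G p.1 p.2].
  by rewrite cards0.
pose o (e : {set T}) := odflt p0 [pick p : T * T | e == [set p.1; p.2]].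
pose o' e := ((o e).2, (o e).1).
apply: (@leq_trans #|(o @: edges_between G A B) :|: (o' @: edges_between G A B)|); last first.
  rewrite cardsU mul2n -addnn; apply: leq_trans (leq_subr _ _) _.
  by apply: leq_add; apply: leq_imset_card.
apply/subset_leq_card/fintype.subsetP => -[x y]; rewrite !inE /= => /andP[/andP[xA yB] xy].
have eS : [set x; y] \in edges_between G A B.
  by rewrite inE; apply/andP; split=> //; apply/existsP; exists (x, y); rewrite /= xA yB eqxx.
have nxy : x != y by have := card_edge xy; rewrite cards2; case: eqP.
case eo : (o [set x; y]) => [u v].
have : [set x; y] == [set u; v].
  move: eo; rewrite /o; case: pickP => [q /= hq /= e|/(_ (x, y))]; last by rewrite eqxx.
  by move: hq; rewrite e.
move=> /eqP e; have : x \in [set u; v] by rewrite -e !inE eqxx.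
have : y \in [set u; v] by rewrite -e !inE eqxx orbT.
rewrite !inE => /orP[]/eqP ey /orP[]/eqP ex; subst x y.
- by rewrite eqxx in nxy.
- by apply/orP; right; apply/imsetP; exists [set v; u]; rewrite // /o' eo.
- by apply/orP; left; apply/imsetP; exists [set u; v]; rewrite // eo.
- by rewrite eqxx in nxy.
Qed.

Section Probability.
Variables (R : realType) (T : finType) (G : sgraph T) (p : R).

Let weight (J : {set {set T}}) : R := \prod_(e in edges G) (if e \in J then p else 1 - p).

(** The sum is extended to all families [J], with a factor [a] that vanishes outside [edges G] and
    on [S]. It then factorises into the product of [a e + b e], which is [1 - p] on [S] and 1
    elsewhere. *)
Lemma prob_avoid (S : {set {set T}}) : S \subset edges G ->
  \sum_(F : sgraph T | (edges F \subset edges G) && [disjoint edges F & S]) weight (edges F) =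
  (1 - p) ^+ #|S|.
Proof.
move=> SG; pose ok (J : {set {set T}}) := (J \subset edges G) && [disjoint J & S].
have okP J : ok J -> [forall e in J, #|e| == 2%N].
  move=> /andP[/fintype.subsetP sJ _]; apply/forall_inP => e /sJ eG.
  by have /forall_inP/(_ e eG) := valP G.
transitivity (\sum_(J : {set {set T}} | ok J) weight J).
  rewrite [RHS](reindex_onto (fun F : sgraph T => edges F) (insubd G)); last first.
    by move=> J /okP hJ; rewrite /edges insubdK.
  by apply: eq_bigl => F; rewrite /edges valKd eqxx andbT.
pose a (e : {set T}) : R := if (e \in edges G) && (e \notin S) then p else 0.
pose b (e : {set T}) : R := if e \in edges G then 1 - p else 1.
transitivity (\sum_(J : {set {set T}}) \prod_e (if e \in J then a e else b e)).
  rewrite big_mkcond /=; apply: eq_bigr => J _; case: ifP => [/andP[JG JS]|nok].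
    rewrite /weight big_mkcond /=; apply: eq_bigr => e _; rewrite /a /b.
    have [eJ|eJ] := boolP (e \in J); last by [].
    by rewrite (fintype.subsetP JG) //= (disjointFr JS).
  have /negbT := nok; rewrite negb_and => no.
  have [e eJ ae] : exists2 e, e \in J & a e = 0.
    case/orP: no => [/subsetPn[e eJ eG]|]; first by exists e; rewrite // /a (negPf eG).
    rewrite -setI_eq0 => /set0Pn[e]; rewrite inE => /andP[eJ eS].
    by exists e; rewrite // /a eS andbF.
  by rewrite (bigD1 e) //= eJ ae mul0r.
rewrite -(bigA_distr _ _ a b).
rewrite -prodr_const [RHS]big_mkcond /=; apply: eq_bigr => e _; rewrite /a /b.
have [eS|eS] := boolP (e \in S); first by rewrite (fintype.subsetP SG) //= add0r.
by case: (e \in edges G); rewrite /= ?add0r // addrC subrK.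
Qed.

Hypothesis p01 : 0 <= p <= 1.

Lemma weight_ge0 J : 0 <= weight J.
Proof.
have /andP[p0 p1] := p01; apply: prodr_ge0 => e _; case: ifP => // _.
by rewrite subr_ge0.
Qed.

Lemma prob_total : \sum_(F : sgraph T | edges F \subset edges G) weight (edges F) = 1.
Proof.
have := @prob_avoid finset.set0 (finset.sub0set _); rewrite cards0 expr0 => <-.
by apply: eq_bigl => F; rewrite -finset.setI_eq0 finset.setI0 eqxx andbT.
Qed.

Lemma prob_le1 (A : pred (sgraph T)) : random_subgraph_prob G p A <= 1.
Proof.
rewrite -prob_total /random_subgraph_prob [leLHS]big_mkcondr /=.
by apply: ler_sum => F _; case: ifP => // _; apply: weight_ge0.
Qed.

(** Union bound: outside [A], some [S i] is missed entirely. *)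
Lemma prob_ge_union (I : finType) (P : pred I) (S : I -> {set {set T}}) (A : pred (sgraph T)) :
  (forall i, S i \subset edges G) ->
  (forall F : sgraph T, edges F \subset edges G ->
     (forall i, P i -> ~~ [disjoint edges F & S i]) -> A F) ->
  1 - \sum_(i | P i) (1 - p) ^+ #|S i| <= random_subgraph_prob G p A.
Proof.
move=> SG hA; rewrite lerBlDr -[leLHS]prob_total (bigID A) /= lerD2l.
rewrite (eq_bigr (fun i => \sum_(F : sgraph T | (edges F \subset edges G) &&
    [disjoint edges F & S i]) weight (edges F))); last first.
  by move=> i _; rewrite prob_avoid.
have -> : \sum_(i | P i) \sum_(F : sgraph T | (edges F \subset edges G) &&
    [disjoint edges F & S i]) weight (edges F) =
    \sum_(F : sgraph T | edges F \subset edges G) \sum_(i | P i) (if [disjoint edges F & S i] then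
        weight (edges F) else 0).
  rewrite [RHS]exchange_big /=; apply: eq_bigr => i _; by rewrite big_mkcondr.
rewrite [leLHS]big_mkcondr /=; apply: ler_sum => F FG; case: ifP => [nA|_].
  have [i /andP[Pi di]] : exists i, P i && [disjoint edges F & S i].
    apply/existsP; apply: contraR nA => /existsPn h; apply: hA => // i Pi.
    by have := h i; rewrite Pi.
  rewrite (bigD1 i) //= di lerDl; apply: sumr_ge0 => j _.
  by case: ifP => // _; apply: weight_ge0.
by apply: sumr_ge0 => j _; case: ifP => // _; apply: weight_ge0.
Qed.
End Probability.

(** There are $4^n$ pairs of sets. A relevant pair spans at least $n^2/(2D)$ edges, so it is missed
    with probability at most $e^{-pn^2/(2D)}\le e^{-3n}\le 8^{-n}$. *)
Lemma prob_joined_ge (R : realType) n (G : sgraph 'I_n) (p : R) D (A : pred (sgraph 'I_n)) :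
  (0 < n)%N -> (0 < D)%N -> 0 <= p <= 1 -> 6 * D%:R / n%:R <= p ->
  (forall F : sgraph 'I_n,
     (forall X Y : {set 'I_n}, (n ^ 2 <= D * edge_count (edge_rel G) X Y)%N ->
       exists x y, [/\ x \in X, y \in Y & edge_rel F x y]) -> A F) ->
  1 - 2^-1 ^+ n <= random_subgraph_prob G p A.
Proof.
move=> n0 D0 p01 pD hA; have /andP[p0 p1] := p01.
pose P (q : {set 'I_n} * {set 'I_n}) := (n ^ 2 <= D * edge_count (edge_rel G) q.1 q.2)%N.
pose S (q : {set 'I_n} * {set 'I_n}) := edges_between G q.1 q.2.
apply: le_trans (prob_ge_union p01 (P := P) (S := S) _ _); last 2 first.
- by move=> q; apply/fintype.subsetP => e; rewrite inE => /andP[].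
- move=> F FG hF; apply: hA => X Y hXY.
  have := hF (X, Y) hXY; rewrite -finset.setI_eq0 => /set0Pn[e].
  rewrite !inE => /and3P[eF _ /existsP[[x y] /and3P[/= xX yY /eqP exy]]].
  by exists x, y; rewrite /edge_rel -exy.
rewrite lerD2l lerN2.
have n0R : 0 < n%:R :> R by rewrite ltr0n.
have D0R : 0 < D%:R :> R by rewrite ltr0n.
have e3 : 8 <= expR 3 :> R.
  have e1 : 2 <= expR 1 :> R by apply: le_trans (expR_ge1Dx 1); lra.
  have -> : (3 : R) = 3%:R * 1 by rewrite mulr1.
  rewrite expRM_natl; apply: le_trans (_ : 2 ^+ 3 <= _); first by rewrite -natrX ler_nat.
  by apply: lerXn2r => //; rewrite nnegrE ?expR_ge0.
have term q : P q -> (1 - p) ^+ #|S q| <= 8^-1 ^+ n.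
  move=> Pq; have : (n ^ 2 <= 2 * D * #|S q|)%N.
    by apply: leq_trans Pq _; rewrite mulnAC [leqRHS]mulnC leq_mul2l edge_count_le orbT.
  move: #|S q| => s; rewrite -(ler_nat R) natrX !natrM => hs.
  apply: (@le_trans _ _ (expR (- p) ^+ s)).
    by apply: lerXn2r; rewrite ?nnegrE ?expR_ge0 ?subr_ge0 //; apply: expR_ge1Dx.
  apply: (@le_trans _ _ (expR (- 3) ^+ n)); last first.
    by apply: lerXn2r; rewrite ?nnegrE ?expR_ge0 ?invr_ge0 // expRN lef_pV2 ?posrE ?expR_gt0.
  rewrite -!expRM_natr ler_expR !mulNr lerN2.
  apply: (@le_trans _ _ (6 * D%:R / n%:R * s%:R)); last by rewrite ler_wpM2r.
  by rewrite mulrAC ler_pdivlMr // -mulrA -expr2; lra.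
apply: le_trans (ler_sum _ term) _; rewrite sumr_const.
apply: (@le_trans _ _ (8^-1 ^+ n *+ #|{: {set 'I_n} * {set 'I_n}}|)).
  by apply: ler_wpMn2l; [rewrite exprn_ge0 ?invr_ge0|rewrite max_card].
have cs : #|{: {set 'I_n}}| = (2 ^ n)%N by rewrite -cardsT -powersetT card_powerset cardsT card_ord.
rewrite card_prod cs -mulr_natr natrM natrX -!exprMn.
by rewrite (_ : 8^-1 * (2 * 2) = 2^-1) //; field.
Qed.

Local Open Scope classical_set_scope.

Theorem theorem1p13 (R : realType) :
  exists C1 C2 : R, [/\ 0 < C1, 0 < C2 &
    forall beta : R, 0 < beta ->
    exists2 C : R, 0 < C &
    forall (t : nat -> nat) (p : nat -> R) (G : forall n : nat, sgraph 'I_n),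
      (\forall n \near \oo,
        [/\ (3 <= t n)%N,
            C1 / ln (1 / beta) * ln n%:R <= (t n)%:R <= (1 - C2 * beta) * n%:R,
            0 <= p n <= 1,
            C / n%:R <= p n &
            (num_edges (G n))%:R >=
              (extremal_number n (cycle_graph (t n)))%:R + beta * 'C(n, 2)%:R]) ->
      random_subgraph_prob (G n) (p n)
        (fun F => contains_copy F (cycle_graph (t n))) @[n --> \oo] --> (1 : R)].
Proof.
exists 1, 1; split=> // beta beta0.
(* For [1 <= beta] the upper bound on [t] is at most 0, against [3 <= t n]. *)
have [beta1|beta1] := leP 1 beta.
  exists 1 => // t p G near_false.
  have [n [t3 /andP[_ tn] _ _ _]] := filter_ex near_false.
  have : (t n)%:R <= 0 :> R by apply: le_trans tn _; rewrite mul1r mulr_le0_ge0 // subr_le0.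
  by rewrite lern0 => /eqP t0; rewrite t0 in t3.
set lam := ln (1 / beta).
have lam0 : 0 < lam by rewrite ln_gt0 // ltr_pdivlMr // mul1r.
pose b := Num.bound (beta^-1).
have bb : beta^-1 < b%:R by apply: archi_boundP; rewrite invr_ge0 ltW.
have b0 : (0 < b)%N by rewrite -(ltr0n R); apply: lt_trans bb; rewrite invr_gt0.
(* The exponent 6 makes [k ^ l <= n] imply [6 * l <= t n], so that [3 * l] takes at most half of
   [t n]. *)
pose k := (Num.bound ((1 / beta) ^+ 6)).+2.
have lnk : 6 * lam <= ln k%:R.
  have pb : 0 < (1 / beta) ^+ 6 by rewrite exprn_gt0 // divr_gt0.
  have -> : 6 * lam = ln ((1 / beta) ^+ 6) by rewrite lnXn ?divr_gt0 // mulr_natl.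
  rewrite ler_ln ?posrE // ?ltr0n //; apply: ltW; apply: lt_le_trans (archi_boundP (ltW pb)) _.
  by rewrite ler_nat /k; apply/leqW/leqW.
have [D [N [B hdet]]] := joined_contains_cycle b0 (isT : (1 < k)%N).
(* The successor ensures positivity, as [D] might be 0. *)
exists (6 * D.+1%:R); first by rewrite mulr_gt0.
move=> t p G near_hyp.
apply: (@squeeze_cvgr _ _ _ _ (fun n => 1 - 2^-1 ^+ n) (fun=> 1)); last 2 first.
- rewrite -[X in _ --> X]subr0; apply: cvgB; first exact: cvg_cst.
  by apply: cvg_expr; rewrite ger0_norm ?invr_ge0 // invf_lt1 // ltr1n.
- exact: cvg_cst.
(* From [M] on, $\log n$ is at least [2 * B * lam], so [B] fits into the other half of [t n]. *)
pose M := Num.bound (expR (2 * B%:R * lam)).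
have big : \forall n \near \oo, (maxn N.+1 M <= n)%N by exact: nbhs_infty_ge.
apply: filterS2 near_hyp big => n [t3 /andP[tlow _] p01 pC eG].
rewrite geq_max => /andP[Nn Mn].
have n0 : (0 < n)%N by apply: leq_trans Nn.
apply/andP; split; last exact: prob_le1.
apply: (prob_joined_ge (D := D.+1)) => // F hF.
apply: (hdet n (t n) (G n) F (ltnW Nn) t3).
- rewrite -(ler_nat R) natrD !natrM.
  apply: le_trans (_ : b%:R * ((extremal_number n (cycle_graph (t n)))%:R + beta * 'C(n, 2)%:R) <= _).
    by rewrite mulrDr lerD2l mulrA ler_peMl // -ler_pdivrMr // div1r ltW.
  by rewrite ler_wpM2l.
- by move=> X Y h; apply: hF; apply: leq_trans h _; rewrite leq_mul2r leqnSn orbT.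
move=> l kl.
have lt : ln n%:R <= (t n)%:R * lam.
  by move: tlow; rewrite mul1r mulrC ler_pdivrMr.
have h1 : (6 * l <= t n)%N.
  rewrite -(ler_nat R) natrM -(ler_pM2r lam0); apply: le_trans lt.
  apply: le_trans (_ : ln (k ^ l)%:R <= _); last by rewrite ler_ln ?posrE ?ltr0n ?expn_gt0 ?ler_nat.
  rewrite natrX lnXn ?ltr0n // -[leRHS]mulr_natl [6 * _]mulrC -mulrA.
  by rewrite ler_wpM2l.
have h2 : (2 * B <= t n)%N.
  rewrite -(ler_nat R) natrM -(ler_pM2r lam0); apply: le_trans lt.
  rewrite -ler_expR lnK ?posrE ?ltr0n //; apply: ltW.
  by apply: lt_le_trans (archi_boundP (expR_ge0 _)) _; rewrite ler_nat.
by move: h1 h2; clear; lia.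
Qed.
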